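(* Planes and circular cylinders are the only $\lambda$-translating solitons of the Gauss curvature flow with constant mean curvature. That is, let $\lambda\in\mathbb{R}$, let $\vec v\in\mathbb{R}^3$ be a unit vector, and let $\Sigma$ be a $\lambda$-translating soliton of the Gauss curvature flow with respect to $\vec v$; if the mean curvature $H$ of $\Sigma$ is constant, then $\Sigma$ is a plane or a circular cylinder.
   Context: $\Sigma$ is an orientable surface immersed in Euclidean space $\mathbb{R}^3$, with unit normal $N$ (Gauss map). The principal curvatures $\kappa_1,\kappa_2$ are the eigenvalues of the shape operator $SX=-\overline\nabla_X N$ ($\overline\nabla$ the Levi-Civita connection of $\mathbb{R}^3$), $H=\frac{\kappa_1+\kappa_2}{2}$ is the mean curvature and $K=\kappa_1\kappa_2$ is the Gauss curvature. Given $\lambda\in\mathbb{R}$ and a unit vector $\vec v\in\mathbb{R}^3$, the surface $\Sigma$ is a $\lambda$-translating soliton of the Gauss curvature flow (with respect to $\vec v$) if $K=\langle N,\vec v\rangle+\lambda$ on $\Sigma$. *)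

(* Defs.v *)
From HB Require Import structures.
From mathcomp Require Import all_boot all_order all_algebra.
From mathcomp Require Import all_classical all_reals all_analysis.

Set Implicit Arguments.
Unset Strict Implicit.
Unset Printing Implicit Defensive.

Import Order.TTheory GRing.Theory Num.Theory.
Import numFieldNormedType.Exports.

Local Open Scope classical_set_scope.
Local Open Scope ring_scope.

(* The library norm on row vectors is the sup norm, so Euclidean lengths are
   expressed through [dot]. *)
Definition dot (R : realType) (n : nat) (x y : 'rV[R]_n) : R :=
  \sum_i x 0 i * y 0 i.

(* [Cn k D f] is meaningful for D open: f is of class C^k on D. *)
Fixpoint Cn (R : realType) (m n : nat) (k : nat) (D : set 'rV[R]_m.+1)
    (f : 'rV[R]_m.+1 -> 'rV[R]_n.+1) : Prop :=
  match k with
  | 0 => forall u, D u -> {for u, continuous f}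
  | k'.+1 => (forall u, D u -> differentiable f u) /\
             (forall w, Cn k' D ('D_w f))
  end.

Definition smooth (R : realType) (m n : nat) (D : set 'rV[R]_m.+1)
    (f : 'rV[R]_m.+1 -> 'rV[R]_n.+1) : Prop :=
  forall k, Cn k D f.

(* A homeomorphism between an open set of M and an open set of R^2; the values
   of the two maps outside these open sets are irrelevant. *)
Record chart (R : realType) (M : topologicalType) := Chart {
  chart_dom : set M ;
  chart_cod : set 'rV[R]_2 ;
  chart_map : M -> 'rV[R]_2 ;
  chart_inv : 'rV[R]_2 -> M ;
  chart_dom_open : open chart_dom ;
  chart_cod_open : open chart_cod ;
  chart_mapP : forall p, chart_dom p -> chart_cod (chart_map p) ;
  chart_invP : forall u, chart_cod u -> chart_dom (chart_inv u) ;
  chart_mapK : forall p, chart_dom p -> chart_inv (chart_map p) = p ;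
  chart_invK : forall u, chart_cod u -> chart_map (chart_inv u) = u ;
  chart_map_continuous : forall p, chart_dom p -> {for p, continuous chart_map} ;
  chart_inv_continuous : forall u, chart_cod u -> {for u, continuous chart_inv}
}.

Record surface (R : realType) := Surface {
  surface_sort :> topologicalType ;
  surface_hausdorff : hausdorff_space surface_sort ;
  surface_second_countable : @second_countable surface_sort ;
  atlas : set (chart R surface_sort) ;
  atlas_cover : forall p, exists2 c, atlas c & chart_dom c p ;
  atlas_smooth : forall c d, atlas c -> atlas d ->
    smooth (chart_cod c `&` chart_inv c @^-1` chart_dom d)
           (chart_map d \o chart_inv c)
}.

Section ImmersedSurface.
Variables (R : realType) (M : surface R).

Definition smooth_map (f : M -> 'rV[R]_3) : Prop :=
  forall c, atlas c -> smooth (chart_cod c) (f \o chart_inv c).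

Definition immersion (f : M -> 'rV[R]_3) : Prop :=
  smooth_map f /\
  forall c u, atlas c -> chart_cod c u -> injective ('d (f \o chart_inv c) u).

Definition gauss_map (f N : M -> 'rV[R]_3) : Prop :=
  [/\ smooth_map N,
      forall p, dot (N p) (N p) = 1 &
      forall c u w, atlas c -> chart_cod c u ->
        dot (N (chart_inv c u)) ('d (f \o chart_inv c) u w) = 0].

(* S is the matrix, acting on row vectors and in the coordinates of the chart
   c at u, of the shape operator X |-> - \overline\nabla_X N: for the tangent
   vector X = df(w) one has \overline\nabla_X N = dN(w). *)
Definition shape_operator (f N : M -> 'rV[R]_3) (c : chart R M)
    (u : 'rV[R]_2) (S : 'M[R]_2) : Prop :=
  forall w, 'd (f \o chart_inv c) u (w *m S) = - 'd (N \o chart_inv c) u w.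

(* k1 p and k2 p are the eigenvalues, with multiplicity, of the shape operator
   at p, in whichever chart it is expressed. *)
Definition principal_curvatures (f N : M -> 'rV[R]_3) (k1 k2 : M -> R) : Prop :=
  forall c p, atlas c -> chart_dom c p ->
    exists2 S, shape_operator f N c (chart_map c p) S &
      char_poly S = ('X - (k1 p)%:P) * ('X - (k2 p)%:P).

Definition mean_curvature (k1 k2 : M -> R) (p : M) : R := (k1 p + k2 p) / 2.

Definition gauss_curvature (k1 k2 : M -> R) (p : M) : R := k1 p * k2 p.

Definition translating_soliton (N : M -> 'rV[R]_3) (k1 k2 : M -> R)
    (v : 'rV[R]_3) (lambda : R) : Prop :=
  forall p, gauss_curvature k1 k2 p = dot (N p) v + lambda.

End ImmersedSurface.

Definition is_plane (R : realType) (P : set 'rV[R]_3) : Prop :=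
  exists a n, n != 0 /\ P = [set y | dot (y - a) n = 0].

(* The points at distance r from the line through a with unit direction e. *)
Definition is_circular_cylinder (R : realType) (C : set 'rV[R]_3) : Prop :=
  exists a e r, [/\ dot e e = 1, 0 < r &
    C = [set y | dot (y - a) (y - a) - dot (y - a) e ^+ 2 = r ^+ 2]].

Definition open_part (T : topologicalType) (A B : set T) : Prop :=
  exists2 O, open O & A = B `&` O.

(* Main.v *)
(* Let [k1 = H + mu], [k2 = H - mu], so that [K = H^2 - mu^2]. Where [mu <> 0] there
   is a smooth orthonormal principal frame [T1], [T2]; put [v_i = <T_i, v>] and
   [v3 = <N, v> = H^2 - lambda - mu^2]. Codazzi's equations express the connection
   form of the frame by the derivatives of [mu], and the soliton equation gives
   [2 mu T_i(mu) = k_i v_i]; hence every derivative of [mu], [v1], [v2] is an explicit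
   function of [mu], [v1], [v2]. In these terms Gauss' equation and its derivative
   along [T1] are two equations in [v1^2], [v2^2] with proportional left-hand sides,
   and eliminating them leaves a nonzero polynomial equation for [mu] alone. So [mu]
   is locally constant where it does not vanish, the connection form vanishes, and
   Gauss' equation reads [K = 0].

   By connectedness either [K = H^2] everywhere, or [K = 0] everywhere with [H <> 0].
   In the first case the surface is umbilic; [H <> 0] would make [<N, v>] constant,
   which forces [v] to be normal, hence [N] constant, which is absurd; so [H = 0] and
   [N] is constant. In the second case the flat principal direction is a constant
   vector [e] and [X + N / 2H] stays on a line of direction [e]. The image is
   open in the plane or cylinder because a point [y] close to it has a critical point
   of [|X - y|^2] nearby, where [X - y] is normal and therefore zero. *)

Require Import Defs.
From HB Require Import structures.
From mathcomp Require Import all_boot all_order all_algebra.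
From mathcomp Require Import all_classical all_reals all_analysis.
From mathcomp Require Import ring lra.
Import Order.TTheory GRing.Theory Num.Theory.
Import numFieldNormedType.Exports.
Local Open Scope classical_set_scope.
Local Open Scope ring_scope.

Set Implicit Arguments.
Unset Strict Implicit.
Unset Printing Implicit Defensive.

(** * Smooth real functions *)

Section SmoothFunctions.
Variables (R : realType) (V : normedModType R).
Implicit Types (D : set V) (f g h : V -> R).

(** Scalar counterpart of [Cn], on any normed space. Vector-valued maps are later treated coordinate
    by coordinate, so that products, inverses and square roots of real functions are available. *)
Fixpoint Ck (k : nat) D h : Prop :=
  match k with
  | 0 => forall u, D u -> {for u, continuous h}
  | k'.+1 => (forall u, D u -> differentiable h u) /\
             (forall w, Ck k' D ('D_w h))
  end.

Definition Cinf D h := forall k, Ck k D h.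

Lemma differentiable_eqon D f g u : open D -> {in D, f =1 g} -> D u ->
  differentiable f u -> differentiable g u.
Proof.
move=> oD fg Du df.
have nfg : \forall x \near u, f x = g x.
  by near=> x; apply: fg; rewrite inE; near: x; exact: open_nbhs_nbhs.
have fgu : f u = g u by apply: fg; rewrite inE.
apply/diff_locallyP.
have [dc de] := (diff_locallyP _ _).1 df.
have dg : g \o shift u = cst (g u) + 'd f u +o_ 0 id.
  apply/eqaddoP => e e0.
  move/eqaddoP: de => /(_ e e0) de.
  have := nfg; rewrite (near_shift 0 u) subr0 => nfg0.
  near=> x.
  have -> : (g \o shift u - (cst (g u) + 'd f u)) x
     = (f \o shift u - (cst (f u) + 'd f u)) x.
    rewrite !fctE /= fgu; congr (_ - _); symmetry.
    by near: x.
  by near: x.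
have -> : 'd g u = 'd f u :> (V -> R) by exact: diff_unique.
by split.
Unshelve. all: by end_near. Qed.

Lemma derive_eqon D f g u w : open D -> {in D, f =1 g} -> D u ->
  'D_w f u = 'D_w g u.
Proof.
move=> oD fg Du; apply: near_eq_derive.
by near=> x; apply: fg; rewrite inE; near: x; exact: open_nbhs_nbhs.
Unshelve. all: by end_near. Qed.

Lemma Ck_eqon k D f g : open D -> {in D, f =1 g} -> Ck k D f -> Ck k D g.
Proof.
move=> oD; elim: k f g => [|k IH] f g fg /=.
  move=> cf u Du; have := cf u Du; rewrite /continuous_at /prop_for.
  have fgu : f u = g u by apply: fg; rewrite inE.
  rewrite fgu => cfu; apply: cvg_trans cfu; apply: near_eq_cvg.
  by near=> x; apply: fg; rewrite inE; near: x; exact: open_nbhs_nbhs.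
move=> [df Df]; split.
  by move=> u Du; exact: differentiable_eqon oD fg Du (df _ Du).
move=> w; apply: IH (Df w) => u; rewrite inE => Du.
exact: derive_eqon oD fg Du.
Unshelve. all: by end_near. Qed.

Lemma CkW k D f : Ck k.+1 D f -> Ck k D f.
Proof.
elim: k f => [|k IH] f [df Df] /=.
  by move=> u Du; exact/differentiable_continuous/df.
by split=> // w; apply: IH; exact: Df.
Qed.

Lemma Cinf_differentiable D f u : Cinf D f -> D u -> differentiable f u.
Proof. by move=> /(_ 1) /= [df _] /df. Qed.

Lemma Cinf_continuous D f u : Cinf D f -> D u -> {for u, continuous f}.
Proof. by move=> sf; exact: (sf 0). Qed.

Lemma Cinf_derivable D f u w : Cinf D f -> D u -> derivable f u w.
Proof. by move=> sf Du; exact/diff_derivable/(Cinf_differentiable sf). Qed.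

Lemma Cinf_derive D f w : Cinf D f -> Cinf D ('D_w f).
Proof. by move=> sf k; have [_ /(_ w)] := sf k.+1. Qed.

Lemma Cinf_eqon D f g : open D -> {in D, f =1 g} -> Cinf D f -> Cinf D g.
Proof. by move=> oD fg sf k; exact: Ck_eqon (sf k). Qed.

Lemma Ck_sub k D E f : E `<=` D -> Ck k D f -> Ck k E f.
Proof.
move=> ED; elim: k f => [|k IH] f /=; first by move=> cf u /ED /cf.
by case=> df Df; split=> [u /ED /df//|w]; exact: IH.
Qed.

Lemma Cinf_sub D E f : E `<=` D -> Cinf D f -> Cinf E f.
Proof. by move=> ED sf k; exact: Ck_sub (sf k). Qed.

Lemma Ck_cst k D (a : R) : Ck k D (cst a).
Proof.
elim: k a => [|k IH] a /=; first by move=> u _; exact: cst_continuous.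
split=> [u _|w]; first exact: differentiable_cst.
suff -> : 'D_w (cst a : V -> R) = cst 0 by [].
by apply/funext => u; rewrite derive_cst.
Qed.

Lemma Ck_add k D f g : open D -> Ck k D f -> Ck k D g -> Ck k D (f + g).
Proof.
move=> oD; elim: k f g => [|k IH] f g /=.
  by move=> cf cg u Du; apply: continuousD; [exact: cf|exact: cg].
move=> [df Df] [dg Dg]; split=> [u Du|w].
  by apply: differentiableD; [exact: df|exact: dg].
apply: Ck_eqon oD _ (IH _ _ (Df w) (Dg w)) => u; rewrite inE => Du.
by rewrite deriveD//; apply: diff_derivable; [exact: df|exact: dg].
Qed.

Lemma Ck_mul k D f g : open D -> Ck k D f -> Ck k D g -> Ck k D (f * g).
Proof.
move=> oD; elim: k f g => [|k IH] f g.
  by move=> cf cg u Du; apply: continuousM; [exact: cf|exact: cg].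
move=> sf sg; have [df Df] := sf; have [dg Dg] := sg; split=> [u Du|w].
  by apply: differentiableM; [exact: df|exact: dg].
have := Ck_add oD (IH _ _ (CkW sf) (Dg w)) (IH _ _ (CkW sg) (Df w)).
apply: Ck_eqon oD _ => u; rewrite inE => Du.
by rewrite deriveM//; apply: diff_derivable; [exact: df|exact: dg].
Qed.

(** Induction on [k]: the derivative of [1 / f] is [- f' / f ^ 2], a product of functions already
    known to be of class C^k. *)
Lemma Ck_inv k D f : open D -> (forall u, D u -> f u != 0) -> Ck k D f ->
  Ck k D (fun u => (f u)^-1).
Proof.
move=> oD f0; elim: k => [|k IH] sf.
  by move=> u Du; apply: cvgV; [exact: f0|exact: sf].
have [df Df] := sf; split=> [u Du|w].
  by apply: differentiableV; [exact: df|exact: f0].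
have sV := IH (CkW sf).
have := Ck_mul oD (Ck_mul oD (Ck_cst k D (-1)) (Ck_mul oD sV sV)) (Df w).
apply: Ck_eqon oD _ => u; rewrite inE => Du.
rewrite deriveV//; [|exact: f0|exact/diff_derivable/df].
by rewrite !fctE mulN1r -invfM -expr2.
Qed.

Lemma derivable_sqrt_comp f u w : 0 < f u -> differentiable f u ->
  differentiable (fun x => Num.sqrt (f x)) u /\
  'D_w (fun x => Num.sqrt (f x)) u = (2 * Num.sqrt (f u))^-1 * 'D_w f u.
Proof.
move=> f0 df.
have ds : differentiable (@Num.sqrt R) (f u).
  by apply/derivable1_diffP; have := is_derive1_sqrt f0.
have dc := differentiable_comp df ds.
split=> //; rewrite deriveE// (diff_comp df ds) /= deriveE//.
rewrite (diff1E ds) derive1E derive_sqrt//.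
exact: mulrC.
Qed.

Lemma Ck_sqrt k D f : open D -> (forall u, D u -> 0 < f u) -> Ck k D f ->
  Ck k D (fun u => Num.sqrt (f u)).
Proof.
move=> oD f0; elim: k => [|k IH] sf.
  move=> u Du; apply: continuous_comp; first exact: sf.
  exact: sqrt_continuous.
have [df Df] := sf; split=> [u Du|w].
  by have [] := derivable_sqrt_comp 0 (f0 _ Du) (df _ Du).
have sV := IH (CkW sf).
have s2 : Ck k D (cst 2 * (fun u => Num.sqrt (f u))).
  exact: Ck_mul oD (Ck_cst k D 2) sV.
have s20 u : D u -> (cst 2 * (fun u => Num.sqrt (f u))) u != 0.
  by move=> Du; rewrite !fctE mulf_neq0// ?pnatr_eq0// gt_eqF// sqrtr_gt0 f0.
have := Ck_mul oD (Ck_inv oD s20 s2) (Df w).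
apply: Ck_eqon oD _ => u; rewrite inE => Du.
by have [_ ->] := derivable_sqrt_comp w (f0 _ Du) (df _ Du).
Qed.

Lemma Cinf_cst D (a : R) : Cinf D (cst a).
Proof. by move=> k; exact: Ck_cst. Qed.

Lemma Cinf_add D f g : open D -> Cinf D f -> Cinf D g -> Cinf D (f + g).
Proof. by move=> oD sf sg k; exact: Ck_add. Qed.

Lemma Cinf_mul D f g : open D -> Cinf D f -> Cinf D g -> Cinf D (f * g).
Proof. by move=> oD sf sg k; exact: Ck_mul. Qed.

Lemma Cinf_opp D f : open D -> Cinf D f -> Cinf D (- f).
Proof.
move=> oD sf; apply: Cinf_eqon oD _ (Cinf_mul oD (@Cinf_cst D (-1)) sf) => u _.
by rewrite !fctE mulN1r.
Qed.

Lemma Cinf_inv D f : open D -> (forall u, D u -> f u != 0) -> Cinf D f ->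
  Cinf D (fun u => (f u)^-1).
Proof. by move=> oD f0 sf k; exact: Ck_inv. Qed.

Lemma Cinf_sqrt D f : open D -> (forall u, D u -> 0 < f u) -> Cinf D f ->
  Cinf D (fun u => Num.sqrt (f u)).
Proof. by move=> oD f0 sf k; exact: Ck_sqrt. Qed.

Lemma open_neq0 D f : open D -> Cinf D f -> open [set u | D u /\ f u != 0].
Proof.
move=> oD sf; rewrite openE => u [Du fu0] /=.
have cf := Cinf_continuous sf Du.
near=> x; split; first by near: x; exact: open_nbhs_nbhs.
near: x; exact: cvgr_neq0 cf fu0.
Unshelve. all: by end_near. Qed.

End SmoothFunctions.

(** * Symmetry of second derivatives and mean value arguments *)

Section SecondDerivatives.
Variables (R : realType) (V : normedModType R).
Implicit Types (D : set V) (h : V -> R).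

Lemma is_derive_line h (a v : V) (s : R) : differentiable h (s *: v + a) ->
  is_derive s 1 (fun x : R => h (x *: v + a)) ('D_v h (s *: v + a)).
Proof.
move=> dh.
have dl : is_diff s (fun x : R => x *: v + a) ( *:%R ^~ v).
  have := is_diffD (is_diff_scalel s v) (is_diff_cst a s).
  by move=> H; apply: is_diff_eq H _; rewrite addr0.
have dc := @is_diff_comp _ _ _ _ _ _ _ _ _ dl (differentiableP dh).
apply: DeriveDef; first exact: diff_derivable (ex_diff).
rewrite deriveE; last exact: ex_diff.
by rewrite [X in X 1]diff_val /= scale1r deriveE.
Qed.

Lemma MVT_closed (g dg : R -> R) (a b : R) : a <= b ->
  (forall s, a <= s <= b -> is_derive s 1 g (dg s)) ->
  exists2 x, a <= x <= b & g b - g a = dg x * (b - a).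
Proof.
move=> ab dgP.
have [s sab|s|x xab ->] := @MVT_segment R g dg a b ab.
- by apply: dgP; move: sab; rewrite in_itv /= => /andP[/ltW -> /ltW ->].
- apply: derivable_within_continuous => x; rewrite in_itv /= => /dgP dx.
  exact: ex_derive.
- by exists x => //; move: xab; rewrite in_itv.
Qed.

Lemma second_difference D h (u v w : V) (e : R) : open D -> Cinf D h -> D u ->
  0 < e -> \forall t \near 0^'+,
  `|h (t *: v + (t *: w + u)) - h (t *: v + u) - h (t *: w + u) + h u
    - t ^+ 2 * 'D_w ('D_v h) u| <= e * t ^+ 2.
Proof.
move=> oD sh Du e0.
(* All points involved lie within [t * C] of [u]; with [e'] below, the two first-order remainders
   add up to at most [e * t]. *)
pose C := `|v| + `|w| + 1; have C0 : 0 < C by rewrite /C ltr_wpDl ?addr_ge0.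
have sv := Cinf_derive v sh; have dv := Cinf_differentiable sv Du.
pose e' := e / (2 * C); have e'0 : 0 < e' by rewrite divr_gt0 ?mulr_gt0.
have rem : \forall x \near (0 : V),
    `|'D_v h (x + u) - 'D_v h u - 'd ('D_v h) u x| <= e' * `|x|.
  have /eqaddoP/(_ _ e'0) := diff_locally dv.
  by apply: filterS => x; rewrite !fctE /= opprD addrA.
have inD : \forall x \near (0 : V), D (x + u).
  have : \forall x \near u, D x by exact: open_nbhs_nbhs.
  by rewrite (near_shift 0 u) subr0.
have [r /= r0 rP] := (nbhs_ballP _ _).1 (filterI rem inD).
have P x : `|x| < r -> `|'D_v h (x + u) - 'D_v h u - 'd ('D_v h) u x| <= e' * `|x|
    /\ D (x + u).
  by move=> xr; apply: rP; rewrite -ball_normE /= sub0r normrN.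
near=> t.
have t0 : 0 < t by near: t; exact: nbhs_right_gt.
have tr : t * C < r.
  rewrite -ltr_pdivlMr//; near: t; apply: nbhs_right_lt; exact: divr_gt0.
have b1 s : 0 <= s <= t -> `|s *: v| <= t * C /\ `|s *: v + t *: w| <= t * C.
  move=> /andP[s0 st].
  have sv1 : `|s *: v| <= t * `|v| by rewrite normrZ ger0_norm// ler_wpM2r.
  split; first by rewrite (le_trans sv1)// (ler_wpM2l (ltW t0))// /C -addrA lerDl addr_ge0.
  rewrite (le_trans (ler_normD _ _))// [X in _ + X]normrZ gtr0_norm//.
  rewrite (le_trans (lerD sv1 (lexx _)))// -mulrDr (ler_wpM2l (ltW t0))//.
  by rewrite /C lerDl.
pose phi (s : R) := h (s *: v + (t *: w + u)) - h (s *: v + u).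
have dphi s : 0 <= s <= t -> is_derive s 1 phi
    ('D_v h (s *: v + (t *: w + u)) - 'D_v h (s *: v + u)).
  move=> st; have [n1 n2] := b1 _ st; apply: is_deriveB; apply: is_derive_line.
    apply: Cinf_differentiable sh _; rewrite addrA.
    by have [] := P _ (le_lt_trans n2 tr).
  apply: Cinf_differentiable sh _.
  by have [] := P _ (le_lt_trans n1 tr).
have [xi xit'] := MVT_closed (ltW t0) dphi.
rewrite /phi !scale0r !add0r subr0 => mvt.
have [n1 n2] := b1 _ xit'.
have [P1 _] := P _ (le_lt_trans n1 tr); have [P2 _] := P _ (le_lt_trans n2 tr).
have -> : h (t *: v + (t *: w + u)) - h (t *: v + u) - h (t *: w + u) + h u =
  ('D_v h (xi *: v + (t *: w + u)) - 'D_v h (xi *: v + u)) * t.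
  by rewrite -mvt; ring.
rewrite (deriveE w dv).
have -> : ('D_v h (xi *: v + (t *: w + u)) - 'D_v h (xi *: v + u)) * t -
   t ^+ 2 * 'd ('D_v h) u w =
   (('D_v h (xi *: v + t *: w + u) - 'D_v h u - 'd ('D_v h) u (xi *: v + t *: w))
   - ('D_v h (xi *: v + u) - 'D_v h u - 'd ('D_v h) u (xi *: v))) * t.
  have dw : 'd ('D_v h) u (t *: w) = t * 'd ('D_v h) u w by rewrite linearZ.
  by rewrite linearD dw (addrA (xi *: v)); ring.
rewrite normrM (gtr0_norm t0) expr2 mulrA (ler_wpM2r (ltW t0))//.
rewrite (le_trans (ler_normB _ _))// (le_trans (lerD P2 P1))//.
rewrite -mulrDr (_ : e * t = e' * (t * C + t * C)); last first.
  by rewrite /e'; field; rewrite gt_eqF.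
by rewrite (ler_wpM2l (ltW e'0))// lerD.
Unshelve. all: by end_near. Qed.

Let close_coefficients (x y a b t e : R) : 0 < t -> x = y ->
  `|x - t * a| <= e / 2 * t -> `|y - t * b| <= e / 2 * t -> `|b - a| <= e.
Proof.
move=> t0 <- xa xb; rewrite -(ler_pM2l t0) -{1}(gtr0_norm t0) -normrM.
rewrite (_ : t * (b - a) = (x - t * a) - (x - t * b)); last by ring.
rewrite (le_trans (ler_normB _ _))// (le_trans (lerD xa xb))//.
by rewrite -mulrDl -splitr mulrC.
Qed.

(** The second difference is symmetric in [v] and [w], so after division by [t ^ 2] it approximates
    both mixed derivatives to any precision. *)
Lemma derive_comm D h (u v w : V) : open D -> Cinf D h -> D u ->
  'D_v ('D_w h) u = 'D_w ('D_v h) u.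
Proof.
move=> oD sh Du; apply/eqP; rewrite -subr_eq0 -normr_le0; apply/ler_addgt0Pr => e e0.
rewrite add0r; have e2 : 0 < e / 2 by rewrite divr_gt0.
have d1 := @second_difference D h u v w _ oD sh Du e2.
have d2 := @second_difference D h u w v _ oD sh Du e2.
have [t [[td1 td2] t0]] := filter_ex (filterI (filterI d1 d2) (nbhs_right_gt 0)).
have tt : 0 < t ^+ 2 by rewrite exprn_gt0.
apply: close_coefficients tt _ td1 td2.
by rewrite (addrCA (t *: w)) (addrAC (h _)).
Qed.

Lemma derive_eq0_cst h (u : V) (r : R) :
  (forall x, ball u r x -> differentiable h x) ->
  (forall x w, ball u r x -> 'D_w h x = 0) ->
  forall x, ball u r x -> h x = h u.
Proof.
move=> dh d0 x ux.
pose phi (s : R) := h (s *: (x - u) + u).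
have inb (s : R) : 0 <= s <= 1 -> ball u r (s *: (x - u) + u).
  move=> /andP[s0 s1]; move: ux; rewrite -!ball_normE /= => ux.
  rewrite opprD addrCA subrr addr0 normrN normrZ ger0_norm// distrC in ux *.
  by rewrite (le_lt_trans _ ux)// ler_piMl.
have dphi (s : R) : 0 <= s <= 1 -> is_derive s 1 phi 0.
  move=> s01; rewrite -(d0 _ (x - u) (inb _ s01)); apply: is_derive_line.
  exact/dh/inb.
have [xi _] := MVT_closed ler01 dphi.
rewrite /phi scale0r add0r scale1r subrK mul0r => /eqP.
by rewrite subr_eq0 => /eqP.
Qed.

End SecondDerivatives.

(** * Derivatives along vector fields *)

Section LieDerivative.
Variables (R : realType) (V : normedModType R) (w0 w1 : V).
Implicit Types (D : set V) (f g h p q : V -> R).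

(** The vector field [p w0 + q w1] acting as a derivation; throughout, a field is represented by its
    two coefficient functions. *)
Definition lie p q h : V -> R := p * 'D_w0 h + q * 'D_w1 h.

Lemma lieE p q h u : lie p q h u = p u * 'D_w0 h u + q u * 'D_w1 h u.
Proof. by []. Qed.

Lemma lie_cst p q (a : R) : lie p q (cst a) = 0.
Proof.
by apply/funext => u; rewrite /lie !fctE !derive_cst !mulr0 addr0.
Qed.

Variables (D : set V) (p q : V -> R) (oD : open D).

Lemma Cinf_lie h : Cinf D p -> Cinf D q -> Cinf D h -> Cinf D (lie p q h).
Proof.
move=> sp sq sh; apply: Cinf_add => //.
  by apply: Cinf_mul => //; exact: Cinf_derive.
by apply: Cinf_mul => //; exact: Cinf_derive.
Qed.

Lemma lie_eqon f g u : {in D, f =1 g} -> D u -> lie p q f u = lie p q g u.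
Proof.
by move=> fg Du; rewrite /lie !fctE !(derive_eqon _ oD fg Du).
Qed.

Lemma lie_add f g u : Cinf D f -> Cinf D g -> D u ->
  lie p q (f + g) u = lie p q f u + lie p q g u.
Proof.
move=> sf sg Du.
have df w : derivable f u w by exact: Cinf_derivable sf Du.
have dg w : derivable g u w by exact: Cinf_derivable sg Du.
by rewrite !lieE !deriveD//; ring.
Qed.

Lemma lie_mul f g u : Cinf D f -> Cinf D g -> D u ->
  lie p q (f * g) u = lie p q f u * g u + f u * lie p q g u.
Proof.
move=> sf sg Du.
have dM w : 'D_w (f * g) u = f u * 'D_w g u + g u * 'D_w f u.
  by apply: deriveM; [exact: Cinf_derivable sf Du|exact: Cinf_derivable sg Du].
by rewrite !lieE !dM; ring.
Qed.

Lemma lie_horner (P : {poly R}) f u : Cinf D f -> D u ->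
  Cinf D (fun x => P.[f x]) /\
  lie p q (fun x => P.[f x]) u = P^`().[f u] * lie p q f u.
Proof.
move=> sf Du; elim/poly_ind: P => [|P a [sP IH]].
  rewrite (_ : (fun x => _) = cst 0); last by apply/funext => x; rewrite horner0.
  by split; [exact: Cinf_cst|rewrite lie_cst deriv0 horner0 mul0r].
rewrite (_ : (fun x => _) = (fun x => P.[f x]) * f + cst a); last first.
  by apply/funext => x; rewrite !fctE !hornerE.
have sPf : Cinf D ((fun x => P.[f x]) * f) by exact: Cinf_mul.
split; first by apply: Cinf_add => //; exact: Cinf_cst.
rewrite lie_add//; last exact: Cinf_cst.
rewrite lie_mul// lie_cst IH derivD derivC derivM derivX !hornerE.
by ring.
Qed.

End LieDerivative.

(** The second-order terms are symmetric by [derive_comm] and cancel; what survives is the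
    first-order operator of the commutator field. *)
Lemma lie_bracket (R : realType) (V : normedModType R) (w0 w1 : V) (D : set V)
    (p q p' q' h : V -> R) (u : V) : open D -> Cinf D p -> Cinf D q ->
    Cinf D p' -> Cinf D q' -> Cinf D h -> D u ->
  let L := lie w0 w1 p q in let L' := lie w0 w1 p' q' in
  L (L' h) u - L' (L h) u =
  (L p' u - L' p u) * 'D_w0 h u + (L q' u - L' q u) * 'D_w1 h u.
Proof.
move=> oD sp sq sp' sq' sh Du /=.
have s0 := Cinf_derive w0 sh; have s1 := Cinf_derive w1 sh.
have expand (p1 q1 p2 q2 x y l1 l2 a b c : R) :
    l1 * x + p2 * (p1 * a + q1 * b) + (l2 * y + q2 * (p1 * b + q1 * c)) =
    l1 * x + l2 * y + (p1 * p2 * a + q1 * q2 * c + (q1 * p2 + p1 * q2) * b).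
  by ring.
have symmetric_part (p1 q1 p2 q2 x y l1 l2 l1' l2' a b c : R) :
    l1 * x + l2 * y + (p1 * p2 * a + q1 * q2 * c + (q1 * p2 + p1 * q2) * b) -
    (l1' * x + l2' * y + (p2 * p1 * a + q2 * q1 * c + (q2 * p1 + p2 * q1) * b)) =
    (l1 - l1') * x + (l2 - l2') * y.
  by ring.
have lieh p1 q1 p2 q2 : Cinf D p1 -> Cinf D q1 -> Cinf D p2 -> Cinf D q2 ->
    lie w0 w1 p1 q1 (lie w0 w1 p2 q2 h) u =
    lie w0 w1 p1 q1 p2 u * 'D_w0 h u + lie w0 w1 p1 q1 q2 u * 'D_w1 h u
    + (p1 u * p2 u * 'D_w0 ('D_w0 h) u + q1 u * q2 u * 'D_w1 ('D_w1 h) u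
    + (q1 u * p2 u + p1 u * q2 u) * 'D_w0 ('D_w1 h) u).
  move=> sp1 sq1 sp2 sq2.
  rewrite [lie _ _ p2 q2 h]/lie (@lie_add _ _ _ _ D)//; try exact: Cinf_mul.
  rewrite !(@lie_mul _ _ _ _ D)//.
  rewrite !(lieE _ _ _ _ ('D__ _)) (derive_comm w1 w0 oD sh Du).
  exact: expand.
by rewrite !lieh//; exact: symmetric_part.
Qed.

(* A nonconstant function cannot satisfy a polynomial equation: differentiating
   P(f) = 0 where L f <> 0 lowers the degree of P. *)
Lemma lie_eq0_of_root (R : realType) (V : normedModType R) (w0 w1 : V)
    (D : set V) (p q f : V -> R) (P : {poly R}) : open D ->
  Cinf D p -> Cinf D q -> Cinf D f -> P != 0 ->
  (forall u, D u -> P.[f u] = 0) -> forall u, D u -> lie w0 w1 p q f u = 0.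
Proof.
(* The domain is generalized along with the polynomial, because the induction hypothesis is used on
   the smaller open set where the derivative of [f] does not vanish. *)
elim: {P}(size P) {-2}P (leqnn (size P)) D => [|n IH] P sizeP D oD sp sq sf P0 Pf u Du.
  by move: sizeP P0; rewrite leqn0 size_poly_eq0 => ->.
apply: contrapT => /eqP Lf.
pose D' := [set x | D x /\ lie w0 w1 p q f x != 0].
have D'D : D' `<=` D by move=> x [].
have oD' : open D' by apply: open_neq0 => //; exact: Cinf_lie.
have P'f x : D' x -> P^`().[f x] = 0.
  move=> [Dx Lx]; have [_] := lie_horner w0 w1 p q oD P sf Dx.
  rewrite (lie_eqon _ _ _ _ oD (g := cst 0) _ Dx); last first.
    by move=> y; rewrite inE => Dy; rewrite Pf.
  rewrite lie_cst => /esym/eqP; rewrite mulf_eq0 (negPf Lx) orbF.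
  by move/eqP.
have D'u : D' u by [].
have [P'0|P'0] := eqVneq P^`() 0; last first.
  have sP' : (size P^`() <= n)%N by rewrite -ltnS (leq_trans (lt_size_deriv P0)).
  have := IH _ sP' _ oD' (Cinf_sub D'D sp) (Cinf_sub D'D sq) (Cinf_sub D'D sf) P'0 P'f u D'u.
  by move/eqP; rewrite (negPf Lf).
have sP1 : (size P <= 1)%N.
  rewrite leqNgt; apply/negP => sP.
  have := congr1 (fun Q : {poly R} => Q`_(size P).-2) P'0.
  rewrite coef_deriv coef0 prednK; last by rewrite -ltnS prednK// (ltn_trans _ sP).
  move/eqP; rewrite mulrn_eq0 -[_`_ _]/(lead_coef P) lead_coef_eq0 (negPf P0) orbF.
  by rewrite -subn1 subn_eq0 leqNgt sP.
have := Pf u Du; rewrite (size1_polyC sP1) hornerC => P00.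
by move: P0; rewrite (size1_polyC sP1) P00 eqxx.
Qed.

(** * Euclidean inner product and vector-valued functions *)

Section DotProduct.
Variables (R : realType) (n : nat).
Implicit Types (x y z : 'rV[R]_n) (a : R).

Lemma dotC x y : dot x y = dot y x.
Proof. by apply: eq_bigr => i _; rewrite mulrC. Qed.

Lemma dotDl x y z : dot (x + y) z = dot x z + dot y z.
Proof. by rewrite -big_split; apply: eq_bigr => i _; rewrite mxE mulrDl. Qed.

Lemma dotZl a x y : dot (a *: x) y = a * dot x y.
Proof. by rewrite mulr_sumr; apply: eq_bigr => i _; rewrite mxE mulrA. Qed.

Lemma dotNl x y : dot (- x) y = - dot x y.
Proof. by rewrite -scaleN1r dotZl mulN1r. Qed.

Lemma dot0l x : dot 0 x = 0.
Proof. by rewrite -(scale0r 0) dotZl mul0r. Qed.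

Lemma dotDr x y z : dot z (x + y) = dot z x + dot z y.
Proof. by rewrite dotC dotDl !(dotC _ z). Qed.

Lemma dotZr a x y : dot y (a *: x) = a * dot y x.
Proof. by rewrite dotC dotZl dotC. Qed.

Lemma dotNr x y : dot y (- x) = - dot y x.
Proof. by rewrite dotC dotNl dotC. Qed.

Lemma dot0r x : dot x 0 = 0.
Proof. by rewrite dotC dot0l. Qed.

Lemma dot_ge0 x : 0 <= dot x x.
Proof. by apply: sumr_ge0 => i _; rewrite -expr2 sqr_ge0. Qed.

Lemma dot_eq0 x : dot x x = 0 -> x = 0.
Proof.
move/eqP; rewrite psumr_eq0 => [/allP x0|i _]; last by rewrite -expr2 sqr_ge0.
apply/rowP => i; rewrite mxE; have := x0 i (mem_index_enum _).
by rewrite /= mulf_eq0 orbb => /eqP.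
Qed.

Lemma dot_gt0 x : x != 0 -> 0 < dot x x.
Proof. by move=> x0; rewrite lt_neqAle dot_ge0 andbT; apply: contraNN x0 => /eqP /esym/dot_eq0 ->. Qed.

Definition dotE := (dotDl, dotDr, dotZl, dotZr, dotNl, dotNr, dot0l, dot0r).

End DotProduct.

(** The matrix [M] with rows [a], [b], [c] satisfies [M M^T = 1], hence also [M^T M = 1] since it is
    square; the expansion is [w = w M^T M]. *)
Lemma orthonormal_expand (R : realType) (a b c w : 'rV[R]_3) :
  dot a a = 1 -> dot b b = 1 -> dot c c = 1 ->
  dot a b = 0 -> dot a c = 0 -> dot b c = 0 ->
  w = dot w a *: a + dot w b *: b + dot w c *: c.
Proof.
move=> aa bb cc ab ac bc.
pose e (i : 'I_3) := if i == 0 then a else if i == 1 then b else c.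
pose M : 'M[R]_3 := \matrix_(i, j) e i 0 j.
have MMT : M *m M^T = 1%:M.
  apply/matrixP => i j; rewrite !mxE.
  rewrite (_ : \sum_k _ = dot (e i) (e j)); last first.
    by apply: eq_bigr => k _; rewrite !mxE.
  case: i => [[|[|[|//]]] ?]; case: j => [[|[|[|//]]] ?]; rewrite /e /= ?eqE /=;
  by rewrite // dotC.
have -> : w = w *m M^T *m M by rewrite -mulmxA (mulmx1C MMT) mulmx1.
have wM : w *m M^T *m M = w by rewrite -mulmxA (mulmx1C MMT) mulmx1.
rewrite wM; apply/rowP => j; rewrite -{1}wM !mxE !big_ord_recl big_ord0 addr0 addrA.
rewrite !mxE; congr (_ * _ + _ * _ + _ * _);
by apply: eq_bigr => k _; rewrite !mxE.
Qed.

Section VectorFields.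
Variables (R : realType) (V : normedModType R) (w0 w1 : V) (n : nat).
Implicit Types (D : set V) (F G : V -> 'rV[R]_n) (a p q : V -> R).

Definition CinfV D F := forall j, Cinf D (fun u => F u 0 j).

Definition lieV p q F (u : V) : 'rV[R]_n :=
  \row_j lie w0 w1 p q (fun x => F x 0 j) u.

Lemma CinfV_sub D E F : E `<=` D -> CinfV D F -> CinfV E F.
Proof. by move=> ED sF j; exact: Cinf_sub (sF j). Qed.

Lemma CinfV_cst D (c : 'rV[R]_n) : CinfV D (cst c).
Proof. by move=> j; exact: Cinf_cst. Qed.

Lemma lieV_cst p q (c : 'rV[R]_n) u : lieV p q (cst c) u = 0.
Proof. by apply/rowP => j; rewrite !mxE [lie _ _ _ _ _]lie_cst. Qed.

Variables (D : set V) (oD : open D).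

Lemma Cinf_sum (I : Type) (r : seq I) (f : I -> V -> R) :
  (forall i, Cinf D (f i)) -> Cinf D (\sum_(i <- r) f i).
Proof.
move=> sf; elim: r => [|i r IH]; first by rewrite big_nil; exact: Cinf_cst.
by rewrite big_cons; exact: Cinf_add.
Qed.

Lemma lie_sum (I : Type) (r : seq I) (f : I -> V -> R) p q u :
  (forall i, Cinf D (f i)) -> D u ->
  lie w0 w1 p q (\sum_(i <- r) f i) u = \sum_(i <- r) lie w0 w1 p q (f i) u.
Proof.
move=> sf Du; elim: r => [|i r IH].
  by rewrite !big_nil [lie _ _ _ _ _]lie_cst.
by rewrite !big_cons (lie_add _ _ _ _ _ _ Du)// ?IH//; exact: Cinf_sum.
Qed.

Let dot_fctE F G :
  (fun x => dot (F x) (G x)) = \sum_i (fun x => F x 0 i) * (fun x => G x 0 i).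
Proof. by apply/funext => x; rewrite fct_sumE. Qed.

Lemma Cinf_dot F G : CinfV D F -> CinfV D G ->
  Cinf D (fun x => dot (F x) (G x)).
Proof.
by move=> sF sG; rewrite dot_fctE; apply: Cinf_sum => i; exact: Cinf_mul.
Qed.

Lemma lie_dot F G p q u : CinfV D F -> CinfV D G -> D u ->
  lie w0 w1 p q (fun x => dot (F x) (G x)) u =
  dot (lieV p q F u) (G u) + dot (F u) (lieV p q G u).
Proof.
move=> sF sG Du; rewrite dot_fctE lie_sum//; last first.
  by move=> i; exact: Cinf_mul.
rewrite -big_split; apply: eq_bigr => i _.
by rewrite (lie_mul _ _ _ _ (sF i) (sG i) Du) !mxE.
Qed.

Lemma lieV_eqon F G p q u : {in D, F =1 G} -> D u ->
  lieV p q F u = lieV p q G u.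
Proof.
move=> FG Du; apply/rowP => j; rewrite !mxE; apply: (lie_eqon _ _ _ _ oD) => // x Dx.
by rewrite FG.
Qed.

Lemma CinfV_scale a F : Cinf D a -> CinfV D F -> CinfV D (fun x => a x *: F x).
Proof.
move=> sa sF j.
rewrite (_ : (fun _ => _) = a * (fun x => F x 0 j)); first exact: Cinf_mul.
by apply/funext => x; rewrite mxE.
Qed.

Lemma lieV_scale a F p q u : Cinf D a -> CinfV D F -> D u ->
  lieV p q (fun x => a x *: F x) u =
  lie w0 w1 p q a u *: F u + a u *: lieV p q F u.
Proof.
move=> sa sF Du; apply/rowP => j; rewrite !mxE -(lie_mul _ _ _ _ sa (sF j) Du).
by congr (lie _ _ _ _ _ u); apply/funext => x; rewrite mxE.
Qed.

Lemma CinfV_add F G : CinfV D F -> CinfV D G -> CinfV D (fun x => F x + G x).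
Proof.
move=> sF sG j.
rewrite (_ : (fun _ => _) = (fun x => F x 0 j) + (fun x => G x 0 j)).
  exact: Cinf_add.
by apply/funext => x; rewrite mxE.
Qed.

Lemma lieV_add F G p q u : CinfV D F -> CinfV D G -> D u ->
  lieV p q (fun x => F x + G x) u = lieV p q F u + lieV p q G u.
Proof.
move=> sF sG Du; apply/rowP => j; rewrite !mxE -(lie_add _ _ _ _ (sF j) (sG j) Du).
by congr (lie _ _ _ _ _ u); apply/funext => x; rewrite mxE.
Qed.

Lemma CinfV_lieV F p q : Cinf D p -> Cinf D q -> CinfV D F -> CinfV D (lieV p q F).
Proof.
move=> sp sq sF j.
rewrite (_ : (fun _ => _) = lie w0 w1 p q (fun x => F x 0 j)).
  exact: Cinf_lie.
by apply/funext => x; rewrite mxE.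
Qed.

Lemma dot_lieV F G p q (c : R) u : CinfV D F -> CinfV D G ->
  (forall x, D x -> dot (F x) (G x) = c) -> D u ->
  dot (lieV p q F u) (G u) = - dot (F u) (lieV p q G u).
Proof.
move=> sF sG FG Du; apply/eqP; rewrite -addr_eq0 -lie_dot//.
rewrite (lie_eqon _ _ _ _ oD (g := cst c) _ Du); first by rewrite lie_cst.
by move=> x; rewrite inE => /FG.
Qed.

(** The coefficients of the commutator are frozen at their values at [u], which is harmless since a
    derivation at [u] sees only those values. *)
Lemma lieV_bracket F p q p' q' u : Cinf D p -> Cinf D q -> Cinf D p' ->
    Cinf D q' -> CinfV D F -> D u ->
  lieV p q (lieV p' q' F) u - lieV p' q' (lieV p q F) u =
  lieV (fun _ => lie w0 w1 p q p' u - lie w0 w1 p' q' p u)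
       (fun _ => lie w0 w1 p q q' u - lie w0 w1 p' q' q u) F u.
Proof.
move=> sp sq sp' sq' sF Du; apply/rowP => j; rewrite !mxE.
have rowE r s : (fun x => lieV r s F x 0 j) = lie w0 w1 r s (fun x => F x 0 j).
  by apply/funext => x; rewrite mxE.
by rewrite !rowE (lie_bracket _ _ oD sp sq sp' sq' (sF j) Du).
Qed.

End VectorFields.

Definition pderiv (R : realType) (V : normedModType R) (n : nat) (w : V)
    (F : V -> 'rV[R]_n) (u : V) : 'rV[R]_n :=
  \row_j 'D_w (fun x => F x 0 j) u.

Lemma lieVE (R : realType) (V : normedModType R) (n : nat) (w0 w1 : V)
    (p q : V -> R) (F : V -> 'rV[R]_n) (u : V) :
  lieV w0 w1 p q F u = p u *: pderiv w0 F u + q u *: pderiv w1 F u.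
Proof. by apply/rowP => j; rewrite !mxE lieE. Qed.

(** * Principal frames *)

(** A moving frame of unit principal directions on a region without umbilics: [mu] is half the
    difference of the principal curvatures. [frame_indep] says that [X] is an immersion; it is what
    makes commutators computable from [X] alone. *)
Record principal_frame (R : realType) (V : normedModType R) (w0 w1 : V)
    (D : set V) (X N : V -> 'rV[R]_3) (H : R) (mu p1 q1 p2 q2 : V -> R) : Prop :=
  PrincipalFrame {
  frame_open : open D ;
  frame_X : CinfV D X ;
  frame_N : CinfV D N ;
  frame_mu : Cinf D mu ;
  frame_p1 : Cinf D p1 ;
  frame_q1 : Cinf D q1 ;
  frame_p2 : Cinf D p2 ;
  frame_q2 : Cinf D q2 ;
  frame_mu_neq0 : forall u, D u -> mu u != 0 ;
  frame_indep : forall u (a b : R), D u ->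
    lieV w0 w1 (cst a) (cst b) X u = 0 -> a = 0 /\ b = 0 ;
  frame_NN : forall u, D u -> dot (N u) (N u) = 1 ;
  frame_11 : forall u, D u ->
    dot (lieV w0 w1 p1 q1 X u) (lieV w0 w1 p1 q1 X u) = 1 ;
  frame_22 : forall u, D u ->
    dot (lieV w0 w1 p2 q2 X u) (lieV w0 w1 p2 q2 X u) = 1 ;
  frame_12 : forall u, D u ->
    dot (lieV w0 w1 p1 q1 X u) (lieV w0 w1 p2 q2 X u) = 0 ;
  frame_1N : forall u, D u -> dot (lieV w0 w1 p1 q1 X u) (N u) = 0 ;
  frame_2N : forall u, D u -> dot (lieV w0 w1 p2 q2 X u) (N u) = 0 ;
  frame_dN1 : forall u, D u ->
    lieV w0 w1 p1 q1 N u = - ((H + mu u) *: lieV w0 w1 p1 q1 X u) ;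
  frame_dN2 : forall u, D u ->
    lieV w0 w1 p2 q2 N u = - ((H - mu u) *: lieV w0 w1 p2 q2 X u)
}.

(** Exchanging the principal directions changes the sign of [mu], so facts proved along the first
    direction transfer to the second. *)
Lemma principal_frame_swap (R : realType) (V : normedModType R) (w0 w1 : V)
    (D : set V) (X N : V -> 'rV[R]_3) (H : R) (mu p1 q1 p2 q2 : V -> R) :
  principal_frame w0 w1 D X N H mu p1 q1 p2 q2 ->
  principal_frame w0 w1 D X N H (- mu) p2 q2 p1 q1.
Proof.
case=> oD sX sN smu sp1 sq1 sp2 sq2 mu0 ind NN f11 f22 f12 f1N f2N dN1 dN2.
split=> //.
- exact: Cinf_opp.
- by move=> u Du; rewrite fctE oppr_eq0 mu0.
- by move=> u Du; rewrite dotC f12.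
- by move=> u Du; rewrite dN1// fctE opprK.
Qed.

Lemma principal_frame_sub (R : realType) (V : normedModType R) (w0 w1 : V)
    (D E : set V) (X N : V -> 'rV[R]_3) (H : R) (mu p1 q1 p2 q2 : V -> R) :
  E `<=` D -> open E ->
  principal_frame w0 w1 D X N H mu p1 q1 p2 q2 ->
  principal_frame w0 w1 E X N H mu p1 q1 p2 q2.
Proof.
move=> ED oE.
case=> oD sX sN smu sp1 sq1 sp2 sq2 mu0 ind NN f11 f22 f12 f1N f2N dN1 dN2.
split=> //; try exact: CinfV_sub ED _; try exact: Cinf_sub ED _;
  try (by move=> u /ED; auto).
by move=> u a b /ED; exact: ind.
Qed.

(** * Structure equations of a principal frame, then Codazzi and Gauss *)

Section StructureEquations.
Variables (R : realType) (V : normedModType R) (w0 w1 : V).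
Variables (D : set V) (X N : V -> 'rV[R]_3) (H : R) (mu p1 q1 p2 q2 : V -> R).
Variable (fr : principal_frame w0 w1 D X N H mu p1 q1 p2 q2).

Local Notation L1 := (lie w0 w1 p1 q1).
Local Notation L2 := (lie w0 w1 p2 q2).
Local Notation LV1 := (lieV w0 w1 p1 q1).
Local Notation LV2 := (lieV w0 w1 p2 q2).
Local Notation T1 := (LV1 X).
Local Notation T2 := (LV2 X).

(** [frame_alpha] and [frame_beta] are the values of the connection form of the frame on its first
    and second vectors. *)
Definition frame_alpha (u : V) : R := dot (LV1 T1 u) (T2 u).
Definition frame_beta (u : V) : R := dot (LV2 T1 u) (T2 u).
Local Notation al := frame_alpha.
Local Notation be := frame_beta.

Let oD := frame_open fr.
Let sX := frame_X fr.
Let sN := frame_N fr.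
Let smu := frame_mu fr.
Let sp1 := frame_p1 fr.
Let sq1 := frame_q1 fr.
Let sp2 := frame_p2 fr.
Let sq2 := frame_q2 fr.

Let sT1 : CinfV D T1. Proof. exact: CinfV_lieV. Qed.
Let sT2 : CinfV D T2. Proof. exact: CinfV_lieV. Qed.

Lemma Cinf_frame_alpha : Cinf D al.
Proof. by apply: Cinf_dot => //; exact: CinfV_lieV. Qed.

Lemma Cinf_frame_beta : Cinf D be.
Proof. by apply: Cinf_dot => //; exact: CinfV_lieV. Qed.

Let eq_opp (x : R) : x = - x -> x = 0.
Proof. by move=> h; lra. Qed.

Let expand u w : D u ->
  w = dot w (T1 u) *: T1 u + dot w (T2 u) *: T2 u + dot w (N u) *: N u.
Proof.
move=> Du; apply: orthonormal_expand; [exact: frame_11 fr _ Du|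
  exact: frame_22 fr _ Du|exact: frame_NN fr _ Du|exact: frame_12 fr _ Du|
  exact: frame_1N fr _ Du|exact: frame_2N fr _ Du].
Qed.

(** Here and in the next three lemmas the derivative is expanded in the frame: one tangential
    component vanishes because the differentiated vector has unit length, and the normal one is
    obtained by moving the derivative onto [N]. *)
Lemma lie1_T1 u : D u -> LV1 T1 u = al u *: T2 u + (H + mu u) *: N u.
Proof.
move=> Du; rewrite [LHS](expand (LV1 T1 u) Du).
have -> : dot (LV1 T1 u) (T1 u) = 0.
  apply: eq_opp; rewrite {1}(dot_lieV w0 w1 oD p1 q1 sT1 sT1 (frame_11 fr) Du).
  by rewrite dotC.
rewrite (dot_lieV w0 w1 oD p1 q1 sT1 sN (frame_1N fr) Du) (frame_dN1 fr Du).
by rewrite !dotE (frame_11 fr Du) mulr1 opprK scale0r add0r.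
Qed.

Lemma lie2_T1 u : D u -> LV2 T1 u = be u *: T2 u.
Proof.
move=> Du; rewrite [LHS](expand (LV2 T1 u) Du).
have -> : dot (LV2 T1 u) (T1 u) = 0.
  apply: eq_opp; rewrite {1}(dot_lieV w0 w1 oD p2 q2 sT1 sT1 (frame_11 fr) Du).
  by rewrite dotC.
rewrite (dot_lieV w0 w1 oD p2 q2 sT1 sN (frame_1N fr) Du) (frame_dN2 fr Du).
by rewrite !dotE (frame_12 fr Du) mulr0 oppr0 oppr0 !scale0r add0r addr0.
Qed.

Lemma lie1_T2 u : D u -> LV1 T2 u = - (al u *: T1 u).
Proof.
move=> Du; rewrite [LHS](expand (LV1 T2 u) Du).
have f21 x : D x -> dot (T2 x) (T1 x) = 0.
  by move=> Dx; rewrite dotC (frame_12 fr).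
have -> : dot (LV1 T2 u) (T2 u) = 0.
  apply: eq_opp; rewrite {1}(dot_lieV w0 w1 oD p1 q1 sT2 sT2 (frame_22 fr) Du).
  by rewrite dotC.
rewrite (dot_lieV w0 w1 oD p1 q1 sT2 sT1 f21 Du) (dotC _ (LV1 T1 u)) -/(al u).
rewrite (dot_lieV w0 w1 oD p1 q1 sT2 sN (frame_2N fr) Du) (frame_dN1 fr Du).
by rewrite !dotE f21// mulr0 oppr0 oppr0 !scale0r !addr0 scaleNr.
Qed.

Lemma lie2_T2 u : D u -> LV2 T2 u = - (be u *: T1 u) + (H - mu u) *: N u.
Proof.
move=> Du; rewrite [LHS](expand (LV2 T2 u) Du).
have f21 x : D x -> dot (T2 x) (T1 x) = 0.
  by move=> Dx; rewrite dotC (frame_12 fr).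
have -> : dot (LV2 T2 u) (T2 u) = 0.
  apply: eq_opp; rewrite {1}(dot_lieV w0 w1 oD p2 q2 sT2 sT2 (frame_22 fr) Du).
  by rewrite dotC.
rewrite (dot_lieV w0 w1 oD p2 q2 sT2 sT1 f21 Du) (dotC _ (LV2 T1 u)) -/(be u).
rewrite (dot_lieV w0 w1 oD p2 q2 sT2 sN (frame_2N fr) Du) (frame_dN2 fr Du).
by rewrite !dotE (frame_22 fr)// mulr1 opprK !scale0r !addr0 scaleNr.
Qed.

(** The connection is torsion free: applied to [X], the commutator is [LV1 T2 - LV2 T1], whose
    normal part is zero. As [X] is an immersion, this fixes the coefficients of the commutator,
    which then acts in the same way on every [F]. *)
Lemma frame_bracket (F : V -> 'rV[R]_3) u : CinfV D F -> D u ->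
  LV1 (LV2 F) u - LV2 (LV1 F) u = - (al u *: LV1 F u) - be u *: LV2 F u.
Proof.
move=> sF Du.
rewrite (lieV_bracket w0 w1 oD sp1 sq1 sp2 sq2 sF Du); set c0 := (fun _ => _); set c1 := (fun _ => _).
have XE : lieV w0 w1 c0 c1 X u = - (al u *: T1 u) - be u *: T2 u.
  by rewrite -(lieV_bracket w0 w1 oD sp1 sq1 sp2 sq2 sX Du) lie1_T2// lie2_T1.
have [] := @frame_indep _ _ _ _ _ _ _ _ _ _ _ _ _ fr u
  (c0 u + al u * p1 u + be u * p2 u) (c1 u + al u * q1 u + be u * q2 u) Du.
  move: XE; rewrite !lieVE.
  move: (pderiv w0 X u) (pderiv w1 X u) => d0 d1 /rowP XE.
  by apply/rowP => j; have /eqP := XE j; rewrite -subr_eq0 !mxE => /eqP <-; rewrite /cst; ring.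
rewrite !lieVE; move: (pderiv w0 F u) (pderiv w1 F u) => d0 d1 e0 e1.
have -> : c0 u = - (al u * p1 u) - be u * p2 u by lra.
have -> : c1 u = - (al u * q1 u) - be u * q2 u by lra.
by apply/rowP => j; rewrite !mxE; ring.
Qed.

End StructureEquations.

Section GaussCodazzi.
Variables (R : realType) (V : normedModType R) (w0 w1 : V).
Variables (D : set V) (X N : V -> 'rV[R]_3) (H : R) (mu p1 q1 p2 q2 : V -> R).
Variable (fr : principal_frame w0 w1 D X N H mu p1 q1 p2 q2).

Local Notation L1 := (lie w0 w1 p1 q1).
Local Notation L2 := (lie w0 w1 p2 q2).
Local Notation LV1 := (lieV w0 w1 p1 q1).
Local Notation LV2 := (lieV w0 w1 p2 q2).
Local Notation T1 := (LV1 X).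
Local Notation T2 := (LV2 X).
Local Notation al := (frame_alpha w0 w1 X p1 q1 p2 q2).
Local Notation be := (frame_beta w0 w1 X p1 q1 p2 q2).

Let oD := frame_open fr.
Let sN := frame_N fr.
Let smu := frame_mu fr.
Let sT1 : CinfV D T1.
Proof. by case: fr => *; exact: CinfV_lieV. Qed.
Let sT2 : CinfV D T2.
Proof. by case: fr => *; exact: CinfV_lieV. Qed.

Let affine (a b : R) : V -> R := cst a + cst b * mu.

Let Cinf_affine a b : Cinf D (affine a b).
Proof.
by apply: Cinf_add => //; [exact: Cinf_cst|apply: Cinf_mul => //; exact: Cinf_cst].
Qed.

Let lie_affine p q a b u : D u ->
  lie w0 w1 p q (affine a b) u = b * lie w0 w1 p q mu u.
Proof.
move=> Du; have sb := Cinf_cst D b; have sa := Cinf_cst D a.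
rewrite /affine (lie_add _ _ _ _ sa (Cinf_mul oD sb smu) Du).
by rewrite (lie_mul _ _ _ _ sb smu Du) !lie_cst mul0r !add0r.
Qed.

(** The commutator is applied to [N], whose derivatives are multiples of the frame vectors. The
    first tangential component gives [L2 mu] and the second gives [L1 mu]; constancy of [H] leaves
    only derivatives of [mu]. *)
Lemma codazzi u : D u ->
  L1 mu u = - 2 * mu u * be u /\ L2 mu u = 2 * mu u * al u.
Proof.
move=> Du; have := frame_bracket fr sN Du.
rewrite (lieV_eqon w0 w1 oD (F := LV2 N) (G := fun x => affine (- H) 1 x *: T2 x) p1 q1 _ Du); last first.
  move=> x; rewrite inE => Dx; rewrite (frame_dN2 fr Dx) -scaleNr /affine.
  by congr (_ *: _); rewrite !fctE; ring.
rewrite (lieV_eqon w0 w1 oD (F := LV1 N) (G := fun x => affine (- H) (- 1) x *: T1 x) p2 q2 _ Du); last first.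
  move=> x; rewrite inE => Dx; rewrite (frame_dN1 fr Dx) -scaleNr /affine.
  by congr (_ *: _); rewrite !fctE; ring.
rewrite !(lieV_scale _ _ _ _ (Cinf_affine _ _) _ Du)// !lie_affine//.
rewrite (lie1_T2 fr Du) (lie2_T1 fr Du) (frame_dN1 fr Du) (frame_dN2 fr Du) => e.
have e1 := congr1 (fun w => dot w (T1 u)) e.
have e2 := congr1 (fun w => dot w (T2 u)) e.
move: e1 e2 {e}; rewrite /= /affine !fctE !dotE (dotC (T2 u) (T1 u)).
rewrite (frame_11 fr Du) (frame_12 fr Du) (frame_22 fr Du).
move: (L1 mu u) (L2 mu u) (al u) (be u) (mu u) => m1 m2 a b m e1 e2.
by split; nra.
Qed.

(** The commutator is applied to the first frame vector, and the component along the second one is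
    read off. *)
Lemma gauss u : D u ->
  L1 be u - L2 al u + (H + mu u) * (H - mu u) + al u ^+ 2 + be u ^+ 2 = 0.
Proof.
move=> Du; have := frame_bracket fr sT1 Du.
have sal := Cinf_frame_alpha fr; have sbe := Cinf_frame_beta fr.
rewrite (lieV_eqon w0 w1 oD (F := LV2 T1) (G := fun x => be x *: T2 x) p1 q1 _ Du); last first.
  by move=> x; rewrite inE => Dx; rewrite (lie2_T1 fr Dx).
rewrite (lieV_eqon w0 w1 oD (F := LV1 T1)
  (G := fun x => al x *: T2 x + affine H 1 x *: N x) p2 q2 _ Du); last first.
  move=> x; rewrite inE => Dx; rewrite (lie1_T1 fr Dx) /affine !fctE.
  by rewrite mul1r.
rewrite (lieV_add w0 w1 p2 q2 (CinfV_scale oD sal sT2) (CinfV_scale oD (Cinf_affine _ _) sN) Du).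
rewrite (lieV_scale w0 w1 p1 q1 sbe sT2 Du) (lieV_scale w0 w1 p2 q2 sal sT2 Du).
rewrite (lieV_scale w0 w1 p2 q2 (Cinf_affine _ _) sN Du) lie_affine//.
rewrite (lie1_T1 fr Du) (lie2_T1 fr Du) (lie1_T2 fr Du) (lie2_T2 fr Du) (frame_dN2 fr Du).
move=> /(congr1 (fun w => dot w (T2 u))) /=; rewrite /affine !fctE !dotE.
rewrite (dotC (N u) (T2 u)).
rewrite (frame_12 fr Du) (frame_22 fr Du) (frame_2N fr Du).
move: (L1 be u) (L2 al u) (L2 mu u) (al u) (be u) (mu u) => b1 a2 m2 a b m e.
by nra.
Qed.

End GaussCodazzi.

(** * Solitons of constant mean curvature in a principal frame *)

Section SolitonRigidity.
Variables (R : realType) (V : normedModType R) (w0 w1 : V).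

(* With [k1 = H + mu], [k2 = H - mu] and [v3 = c - mu^2], the Gauss equation
   becomes [k1^2 v1^2 + k2^2 v2^2 = mu^2 (k1^2 + k2^2) v3 - 4 mu^4 k1 k2];
   where [v1 <> 0], its derivative along the first principal direction has the
   same left-hand side up to the factor [v1 / mu], so that eliminating it leaves
   a polynomial equation for [mu]. *)
Lemma soliton_curvature_polynomial (D : set V) (p1 q1 p2 q2 mu v1 v2 al be : V -> R)
    (H c : R) (u : V) : open D -> Cinf D mu -> Cinf D v1 -> Cinf D v2 ->
  Cinf D al -> Cinf D be ->
  (forall u, D u -> mu u != 0) ->
  (forall u, D u -> lie w0 w1 p1 q1 mu u = - 2 * mu u * be u) ->
  (forall u, D u -> lie w0 w1 p2 q2 mu u = 2 * mu u * al u) ->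
  (forall u, D u -> lie w0 w1 p1 q1 v1 u =
     al u * v2 u + (H + mu u) * (c - mu u ^+ 2)) ->
  (forall u, D u -> lie w0 w1 p1 q1 v2 u = - (al u * v1 u)) ->
  (forall u, D u -> lie w0 w1 p2 q2 v2 u =
     - (be u * v1 u) + (H - mu u) * (c - mu u ^+ 2)) ->
  (forall u, D u -> 2 * mu u * lie w0 w1 p1 q1 mu u = (H + mu u) * v1 u) ->
  (forall u, D u -> 2 * mu u * lie w0 w1 p2 q2 mu u = (H - mu u) * v2 u) ->
  (forall u, D u -> lie w0 w1 p1 q1 be u - lie w0 w1 p2 q2 al u
     + (H + mu u) * (H - mu u) + al u ^+ 2 + be u ^+ 2 = 0) ->
  D u -> v1 u != 0 ->
  (Poly [:: 3 * c * H ^+ 2; c * H + 5 * H ^+ 3; 0; - 6 * H; - 3]).[mu u] = 0.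
Proof.
move=> oD smu sv1 sv2 sal sbe mu0 d1mu d2mu d1v1 d1v2 d2v2 s1 s2 gauss Du v10.
have lieM p q f g x : Cinf D f -> Cinf D g -> D x ->
    lie w0 w1 p q (f * g) x = lie w0 w1 p q f x * g x + f x * lie w0 w1 p q g x.
  exact: lie_mul.
have lieD p q f g x : Cinf D f -> Cinf D g -> D x ->
    lie w0 w1 p q (f + g) x = lie w0 w1 p q f x + lie w0 w1 p q g x.
  exact: lie_add.
have liec p q (a : R) x : lie w0 w1 p q (cst a : V -> R) x = 0.
  by rewrite lie_cst.
have lie0 p q F x : (forall x, D x -> F x = 0) -> D x -> lie w0 w1 p q F x = 0.
  move=> F0 Dx; rewrite (lie_eqon w0 w1 p q oD (g := cst 0) _ Dx) ?liec//.
  by move=> y; rewrite inE => /F0.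
have sM f g : Cinf D f -> Cinf D g -> Cinf D (f * g) by exact: Cinf_mul.
have sA f g : Cinf D f -> Cinf D g -> Cinf D (f + g) by exact: Cinf_add.
have sc (a : R) : Cinf D (cst a : V -> R) by exact: Cinf_cst.
(* Codazzi inserted in the soliton equation ties the connection coefficients to [v1] and [v2]. *)
have e1 x : D x -> (H + mu x) * v1 x + 4 * mu x ^+ 2 * be x = 0.
  by move=> Dx; rewrite -(s1 _ Dx) (d1mu _ Dx); ring.
have e2 x : D x -> (H - mu x) * v2 x - 4 * mu x ^+ 2 * al x = 0.
  by move=> Dx; rewrite -(s2 _ Dx) (d2mu _ Dx); ring.
(* Differentiating [e1] along the first direction and [e2] along the second produces exactly the two
   derivatives of [be] and [al] that occur in Gauss' equation. *)
have e1' x : D x -> - 2 * mu x * be x * v1 x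
    + (H + mu x) * (al x * v2 x + (H + mu x) * (c - mu x ^+ 2))
    - 16 * mu x ^+ 2 * be x ^+ 2 + 4 * mu x ^+ 2 * lie w0 w1 p1 q1 be x = 0.
  move=> Dx; have := @lie0 p1 q1 ((cst H + mu) * v1 + cst 4 * (mu * mu * be)) x.
  rewrite !(liec, lieM, lieD); try by auto.
  rewrite d1mu// d1v1//; move: (lie _ _ _ _ _ _) => b1 /(_ _ Dx) <-; last first.
    by move=> y Dy; rewrite -(e1 _ Dy) !fctE; ring.
  by rewrite !fctE; ring.
have e2' x : D x -> - 2 * mu x * al x * v2 x
    + (H - mu x) * (- (be x * v1 x) + (H - mu x) * (c - mu x ^+ 2))
    - 16 * mu x ^+ 2 * al x ^+ 2 - 4 * mu x ^+ 2 * lie w0 w1 p2 q2 al x = 0.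
  move=> Dx; have := @lie0 p2 q2 ((cst H + cst (-1) * mu) * v2
    + cst (-4) * (mu * mu * al)) x.
  rewrite !(liec, lieM, lieD); try by auto 8.
  rewrite d2mu// d2v2//; move: (lie _ _ _ _ _ _) => a1 /(_ _ Dx) <-; last first.
    by move=> y Dy; rewrite -(e2 _ Dy) !fctE; ring.
  by rewrite !fctE; ring.
(* Gauss' equation once [al], [be] and their derivatives are eliminated. Only [mu], [v1], [v2]
   remain, so it can be differentiated again with known derivatives. *)
pose Q : V -> R := (cst H + mu) * (cst H + mu) * (v1 * v1)
  + (cst H + cst (-1) * mu) * (cst H + cst (-1) * mu) * (v2 * v2)
  + mu * mu * (cst (2 * H ^+ 2) + cst 2 * (mu * mu)) * (mu * mu + cst (- c))
  + cst 4 * (mu * mu * (mu * mu)) * (cst (H ^+ 2) + cst (-1) * (mu * mu)).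
have Q0 x : D x -> Q x = 0.
  move=> Dx; have := e1' x Dx; have := e2' x Dx; have := gauss x Dx.
  have := e1 x Dx; have := e2 x Dx; rewrite /Q !fctE.
  move: (lie _ _ _ _ _ _) (lie _ _ _ _ _ _) => a2 b1.
  move: (al x) (be x) (mu x) (v1 x) (v2 x) => a b m x1 x2 E2 E1 G E2' E1'.
  have E1a : (H + m) * x1 = - 4 * m ^+ 2 * b by lra.
  have E2a : (H - m) * x2 = 4 * m ^+ 2 * a by lra.
  have -> : (H + m) * (H + m) * (x1 * x1) = (- 4 * m ^+ 2 * b) ^+ 2.
    by rewrite -E1a; ring.
  have -> : (H + -1 * m) * (H + -1 * m) * (x2 * x2) = (4 * m ^+ 2 * a) ^+ 2.
    by rewrite -E2a; ring.
  have E1b : b * ((H + m) * x1) = - 4 * m ^+ 2 * b ^+ 2 by rewrite E1a; ring.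
  have E2b : a * ((H - m) * x2) = 4 * m ^+ 2 * a ^+ 2 by rewrite E2a; ring.
  have B : 16 * m ^+ 2 * (a ^+ 2 + b ^+ 2)
     - (2 * H ^+ 2 + 2 * m ^+ 2) * (c - m ^+ 2)
     + 4 * m ^+ 2 * ((H + m) * (H - m)) = 0.
    have b1E : b1 = a2 - (H + m) * (H - m) - a ^+ 2 - b ^+ 2 by lra.
    by rewrite {}b1E in E1'; clear -E1' E2' E1b E2b; nra.
  rewrite -[RHS](mulr0 (m ^+ 2)) -B; ring.
have {lie0} := @lie0 p1 q1 Q u Q0 Du; have := Q0 u Du; rewrite /Q.
rewrite !(liec, lieM, lieD); try by auto 12.
have alE : al u = (H - mu u) * v2 u / (4 * mu u ^+ 2).
  have := e2 u Du; have := mu0 u Du; move: (mu u) (al u) (v2 u) => m a x2 m0 E.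
  have E' : (H - m) * x2 = 4 * m ^+ 2 * a by lra.
  by rewrite E'; field.
have muE : lie w0 w1 p1 q1 mu u = (H + mu u) * v1 u / (2 * mu u).
  have := s1 u Du; have := mu0 u Du; move: (lie _ _ _ _ _ _) (mu u) => l m m0 <-.
  by field.
rewrite muE d1v1// d1v2// alE; have := mu0 u Du; rewrite !fctE.
move: (mu u) (v1 u) (v2 u) v10 => m x1 x2 x10 m0 Qu Q1u.
rewrite !horner_Poly /= mul0r add0r.
(* The factor [4 m ^ 3 x1] is what the elimination leaves in front of the polynomial; it is nonzero
   because [mu] and [v1] are. *)
apply/eqP; rewrite -(inj_eq (mulfI (_ : 4 * m ^+ 3 * x1 != 0))); last first.
  by rewrite !mulf_neq0// ?expf_neq0// pnatr_eq0.
rewrite mulr0; apply/eqP; move: Q1u; set dz := (X in X = 0 -> _) => dz0.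
move: Qu; set z := (X in X = 0 -> _) => z0.
(* The part of [dz] quadratic in the [v_i], with its factor [x1 / m], is cancelled by this
   combination with [z]. *)
rewrite [LHS](_ : _ = 2 * m ^+ 2 * dz - 2 * m * x1 * z).
  by rewrite dz0 z0 !mulr0 subr0.
by rewrite /dz /z; field.
Qed.

End SolitonRigidity.

Section SolitonFrame.
Variables (R : realType) (V : normedModType R) (w0 w1 : V) (X N : V -> 'rV[R]_3).
Variables (H lambda : R) (v : 'rV[R]_3).

(** On the open set where the derivative of [mu] along the first direction is nonzero, the soliton
    equation forces [v1] to be nonzero. So [mu] is a root of the fixed polynomial there, and
    [lie_eq0_of_root] makes that derivative zero, a contradiction. *)
Lemma lie_mu_eq0 (D : set V) (mu p1 q1 p2 q2 : V -> R) :
  principal_frame w0 w1 D X N H mu p1 q1 p2 q2 ->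
  (forall u, D u -> H ^+ 2 - mu u ^+ 2 = dot (N u) v + lambda) ->
  forall u, D u -> lie w0 w1 p1 q1 mu u = 0.
Proof.
move=> fr0 sol u0 Du0; apply: contrapT => /eqP L0.
pose E := [set x | D x /\ lie w0 w1 p1 q1 mu x != 0].
have ED : E `<=` D by move=> x [].
have oE : open E.
  by apply: open_neq0 (frame_open fr0) _; case: fr0 => *; exact: Cinf_lie.
have Eu0 : E u0 by [].
have fr := principal_frame_sub ED oE fr0.
have smu := frame_mu fr; have sN := frame_N fr.
have sp1 := frame_p1 fr; have sq1 := frame_q1 fr.
have sT1 : CinfV E (lieV w0 w1 p1 q1 X) by case: fr => *; exact: CinfV_lieV.
have sT2 : CinfV E (lieV w0 w1 p2 q2 X) by case: fr => *; exact: CinfV_lieV.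
have sv : CinfV E (cst v) by exact: CinfV_cst.
pose v1 x := dot (lieV w0 w1 p1 q1 X x) v; pose v2 x := dot (lieV w0 w1 p2 q2 X x) v.
pose c := H ^+ 2 - lambda.
have v3E x : E x -> dot (N x) v = c - mu x ^+ 2.
  by move=> /ED /sol e; rewrite /c; lra.
have lie_dotv F p q x : CinfV E F -> E x ->
    lie w0 w1 p q (fun y => dot (F y) v) x = dot (lieV w0 w1 p q F x) v.
  by move=> sF Ex; rewrite (lie_dot w0 w1 oE p q sF sv Ex) lieV_cst dot0r addr0.
have lie_v3 p q x : E x ->
    dot (lieV w0 w1 p q N x) v = - (2 * mu x * lie w0 w1 p q mu x).
  move=> Ex; rewrite -lie_dotv//.
  rewrite (lie_eqon w0 w1 p q oE (g := cst c + cst (-1) * (mu * mu)) _ Ex); last first.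
    by move=> y; rewrite inE => /v3E ->; rewrite !fctE; ring.
  have sm := Cinf_mul oE smu smu.
  rewrite (lie_add _ _ _ _ (Cinf_cst _ _) (Cinf_mul oE (Cinf_cst _ _) sm) Ex).
  rewrite (lie_mul _ _ _ _ (Cinf_cst _ _) sm Ex) !lie_cst.
  rewrite (lie_mul _ _ _ _ smu smu Ex) fctE /=; move: (lie _ _ _ _ _ _) => l.
  by rewrite mul0r !add0r; ring.
have s1 x : E x -> 2 * mu x * lie w0 w1 p1 q1 mu x = (H + mu x) * v1 x.
  move=> Ex; have := lie_v3 p1 q1 x Ex; rewrite (frame_dN1 fr Ex) !dotE.
  by move/oppr_inj.
have s2 x : E x -> 2 * mu x * lie w0 w1 p2 q2 mu x = (H - mu x) * v2 x.
  move=> Ex; have := lie_v3 p2 q2 x Ex; rewrite (frame_dN2 fr Ex) !dotE.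
  by move/oppr_inj.
have v1_neq0 x : E x -> v1 x != 0.
  move=> Ex; apply: contraNneq (Ex.2) => v10; have := s1 x Ex.
  by rewrite v10 mulr0 => /eqP; rewrite !mulf_eq0 pnatr_eq0 (negPf (frame_mu_neq0 fr Ex)).
have := L0; apply/negP; rewrite negbK; apply/eqP.
apply: (@lie_eq0_of_root R V w0 w1 E p1 q1 mu
  (Poly [:: 3 * c * H ^+ 2; c * H + 5 * H ^+ 3; 0; - 6 * H; - 3]) oE) => //.
  (* The coefficient of degree 4 is [-3], whatever [H] and [c] are. *)
  apply/eqP => /(congr1 (fun P : {poly R} => P`_4)).
  by rewrite coef_Poly coef0 /= => /eqP; rewrite oppr_eq0 pnatr_eq0.
move=> x Ex.
apply: (@soliton_curvature_polynomial R V w0 w1 E p1 q1 p2 q2 mu v1 v2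
  (frame_alpha w0 w1 X p1 q1 p2 q2) (frame_beta w0 w1 X p1 q1 p2 q2)) => //.
- exact: Cinf_dot.
- exact: Cinf_dot.
- exact: Cinf_frame_alpha fr.
- exact: Cinf_frame_beta fr.
- by move=> y Ey; exact: frame_mu_neq0 fr _ Ey.
- by move=> y Ey; have [] := codazzi fr Ey.
- by move=> y Ey; have [] := codazzi fr Ey.
- move=> y Ey; rewrite /v1 lie_dotv// (lie1_T1 fr Ey) dotDl !dotZl v3E//.
- by move=> y Ey; rewrite /v2 lie_dotv// (lie1_T2 fr Ey) dotNl dotZl.
- by move=> y Ey; rewrite /v2 lie_dotv// (lie2_T2 fr Ey) dotDl dotNl !dotZl v3E.
- by move=> y Ey; exact: gauss fr _ Ey.
- exact: v1_neq0.
Qed.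

(** Swapping the frame gives the vanishing of the other derivative of [mu]; Codazzi then kills the
    connection form, and Gauss reduces to [H ^ 2 - mu ^ 2 = 0]. *)
Lemma soliton_frame_flat (D : set V) (mu p1 q1 p2 q2 : V -> R) (u : V) :
  principal_frame w0 w1 D X N H mu p1 q1 p2 q2 ->
  (forall u, D u -> H ^+ 2 - mu u ^+ 2 = dot (N u) v + lambda) -> D u ->
  [/\ H ^+ 2 = mu u ^+ 2, frame_alpha w0 w1 X p1 q1 p2 q2 u = 0 &
      frame_beta w0 w1 X p1 q1 p2 q2 u = 0].
Proof.
move=> fr sol Du.
have l1 x : D x -> lie w0 w1 p1 q1 mu x = 0 by exact: lie_mu_eq0 fr sol _.
have l2 x : D x -> lie w0 w1 p2 q2 mu x = 0.
  move=> Dx; have oD := frame_open fr; have smu := frame_mu fr.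
  have sol' y : D y -> H ^+ 2 - (- mu) y ^+ 2 = dot (N y) v + lambda.
    by move=> Dy; rewrite -(sol y Dy) fctE sqrrN.
  have := lie_mu_eq0 (principal_frame_swap fr) sol' Dx.
  rewrite (_ : - mu = cst (-1) * mu); last first.
    by apply/funext => y; rewrite !fctE mulN1r.
  rewrite (lie_mul _ _ _ _ (Cinf_cst _ _) smu Dx) lie_cst mul0r add0r mulN1r.
  by move/eqP; rewrite oppr_eq0 => /eqP.
have al0 x : D x -> frame_alpha w0 w1 X p1 q1 p2 q2 x = 0.
  move=> Dx; have [_] := codazzi fr Dx; rewrite l2// => /esym/eqP.
  by rewrite !mulf_eq0 pnatr_eq0 (negPf (frame_mu_neq0 fr Dx)) => /eqP.
have be0 x : D x -> frame_beta w0 w1 X p1 q1 p2 q2 x = 0.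
  move=> Dx; have [+ _] := codazzi fr Dx; rewrite l1// => /esym/eqP.
  by rewrite -mulrA mulf_eq0 mulf_eq0 (negPf (frame_mu_neq0 fr Dx)) oppr_eq0 pnatr_eq0 => /eqP.
split; [|exact: al0|exact: be0].
have lie0 p q g : (forall x, D x -> g x = 0) -> lie w0 w1 p q g u = 0.
  move=> g0; rewrite (lie_eqon w0 w1 p q (frame_open fr) (g := cst 0) _ Du).
    by rewrite lie_cst.
  by move=> y; rewrite inE => /g0.
have := gauss fr Du; rewrite !lie0// al0// be0//.
by rewrite expr0n /= !addr0 subrr add0r mulrC -subr_sqr => /eqP; rewrite subr_eq0 => /eqP.
Qed.

End SolitonFrame.

(** * Existence of principal frames *)

Lemma pderiv0E (R : realType) (V : normedModType R) (n : nat) (w0 w1 : V)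
    (F : V -> 'rV[R]_n) : pderiv w0 F = lieV w0 w1 (cst 1) (cst 0) F.
Proof. by apply/funext => u; rewrite lieVE scale1r scale0r addr0. Qed.

Lemma pderiv1E (R : realType) (V : normedModType R) (n : nat) (w0 w1 : V)
    (F : V -> 'rV[R]_n) : pderiv w1 F = lieV w0 w1 (cst 0) (cst 1) F.
Proof. by apply/funext => u; rewrite lieVE scale1r scale0r add0r. Qed.

Lemma CinfV_pderiv (R : realType) (V : normedModType R) (n : nat) (w : V)
    (D : set V) (F : V -> 'rV[R]_n) : open D -> CinfV D F -> CinfV D (pderiv w F).
Proof.
by move=> oD sF; rewrite (pderiv0E w w); apply: CinfV_lieV => //; exact: Cinf_cst.
Qed.

Lemma pderiv_comm (R : realType) (V : normedModType R) (n : nat) (w w' : V)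
    (D : set V) (F : V -> 'rV[R]_n) (u : V) : open D -> CinfV D F -> D u ->
  pderiv w (pderiv w' F) u = pderiv w' (pderiv w F) u.
Proof.
move=> oD sF Du; apply/rowP => j; rewrite [LHS]mxE [RHS]mxE.
have rowE z : (fun x => pderiv z F x 0 j) = 'D_z (fun x => F x 0 j).
  by apply/funext => x; rewrite mxE.
rewrite !rowE; exact: derive_comm oD (sF j) Du.
Qed.

(** An oriented surface of constant mean curvature in coordinates, umbilics allowed. The matrix of
    the shape operator is only asked to exist at each point, without smooth dependence; its trace
    and determinant carry the curvatures. *)
Record surface_patch (R : realType) (V : normedModType R) (w0 w1 : V)
    (D : set V) (X N : V -> 'rV[R]_3) (H : R) (K : V -> R) : Prop :=
  SurfacePatch {
  patch_open : open D ;
  patch_X : CinfV D X ;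
  patch_N : CinfV D N ;
  patch_NN : forall u, D u -> dot (N u) (N u) = 1 ;
  patch_N0 : forall u, D u -> dot (N u) (pderiv w0 X u) = 0 ;
  patch_N1 : forall u, D u -> dot (N u) (pderiv w1 X u) = 0 ;
  patch_indep : forall u (a b : R), D u ->
    a *: pderiv w0 X u + b *: pderiv w1 X u = 0 -> a = 0 /\ b = 0 ;
  patch_shape : forall u, D u -> exists s00 s01 s10 s11 : R,
    [/\ pderiv w0 N u = - (s00 *: pderiv w0 X u + s01 *: pderiv w1 X u),
        pderiv w1 N u = - (s10 *: pderiv w0 X u + s11 *: pderiv w1 X u),
        s00 + s11 = 2 * H & s00 * s11 - s01 * s10 = K u]
}.

Section FundamentalForms.
Variables (R : realType) (x0 x1 n0 n1 : 'rV[R]_3) (s00 s01 s10 s11 k : R).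
Variables (n0E : n0 = - (s00 *: x0 + s01 *: x1)).
Variables (n1E : n1 = - (s10 *: x0 + s11 *: x1)).

(* An entry of [h - k g], for the fundamental forms [g], [h]: the vectors are
   the derivatives n_i of N and x_i, x_j of X. *)
Definition form_coef (k : R) (ni xi xj : 'rV[R]_3) : R :=
  - dot ni xj - k * dot xi xj.

(** The difference of the two sides is tangent, and the hypotheses say that it is orthogonal to [x0]
    and [x1]; hence it is orthogonal to itself. *)
Lemma principal_directionP (a b : R) :
  a * form_coef k n0 x0 x0 + b * form_coef k n1 x1 x0 = 0 ->
  a * form_coef k n0 x0 x1 + b * form_coef k n1 x1 x1 = 0 ->
  a *: n0 + b *: n1 = - (k *: (a *: x0 + b *: x1)).
Proof.
rewrite /form_coef => e0 e1.
apply/eqP; rewrite -addr_eq0; apply/eqP; apply: dot_eq0.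
set Y := (X in dot X X).
have Y0 : dot Y x0 = 0.
  move: e0; rewrite /Y !dotE.
  move: (dot n0 x0) (dot n1 x0) (dot x0 x0) (dot x1 x0) => d1 d2 d3 d4 e0.
  by rewrite -[RHS]oppr0 -[in RHS]e0; ring.
have Y1 : dot Y x1 = 0.
  move: e1; rewrite /Y !dotE.
  move: (dot n0 x1) (dot n1 x1) (dot x0 x1) (dot x1 x1) => d1 d2 d3 d4 e1.
  by rewrite -[RHS]oppr0 -[in RHS]e1; ring.
have YE : Y = (k * a - a * s00 - b * s10) *: x0 + (k * b - a * s01 - b * s11) *: x1.
  by rewrite /Y n0E n1E; apply/rowP => j; rewrite !mxE; ring.
by clearbody Y; rewrite {1}YE !dotE (dotC x0) (dotC x1) Y0 Y1 !mulr0 addr0.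
Qed.

Lemma form_coef_sym : dot n0 x1 = dot n1 x0 ->
  form_coef k n1 x1 x0 = form_coef k n0 x0 x1.
Proof. by rewrite /form_coef (dotC x0) => ->. Qed.

(** The determinant of [h - k g] is the characteristic polynomial of the shape operator at [k] times
    the determinant of [g]. *)
Lemma form_det (H K : R) : dot n0 x1 = dot n1 x0 -> s00 + s11 = 2 * H ->
  s00 * s11 - s01 * s10 = K -> k ^+ 2 - 2 * H * k + K = 0 ->
  form_coef k n0 x0 x0 * form_coef k n1 x1 x1 = form_coef k n0 x0 x1 ^+ 2.
Proof.
move=> sym tr det kE; rewrite expr2 -{2}(form_coef_sym sym) /form_coef.
rewrite n0E n1E !dotE (dotC x1 x0).
move: (dot x0 x0) (dot x0 x1) (dot x1 x1) => g00 g01 g11.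
have k2 : k ^+ 2 = (s00 + s11) * k - (s00 * s11 - s01 * s10) by rewrite tr det; lra.
apply/eqP; rewrite -subr_eq0; apply/eqP.
rewrite [LHS](_ : _ = (k ^+ 2 - ((s00 + s11) * k - (s00 * s11 - s01 * s10)))
  * (g00 * g11 - g01 ^+ 2)); last by ring.
by rewrite k2 subrr mul0r.
Qed.

(** If [h - k g] vanished, the shape operator would be [k] times the identity, and its trace [2 H]
    would give [k = H]. *)
Lemma form_coef_neq0 (H : R) : s00 + s11 = 2 * H -> k != H ->
  (forall a b : R, a *: x0 + b *: x1 = 0 -> a = 0 /\ b = 0) ->
  form_coef k n1 x1 x0 = form_coef k n0 x0 x1 ->
  ~ [/\ form_coef k n0 x0 x0 = 0, form_coef k n0 x0 x1 = 0 &
        form_coef k n1 x1 x1 = 0].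
Proof.
move=> tr kH ind sym [f00 f01 f11].
have := @principal_directionP 1 0; rewrite sym f00 f01 f11 !mulr0 addr0.
have := @principal_directionP 0 1; rewrite sym f00 f01 f11 !mulr0 addr0.
rewrite !scale0r !scale1r !add0r !addr0 => /(_ erefl erefl) e1 /(_ erefl erefl) e0.
have [|s00k _] := ind (s00 - k) s01.
  move: e0; rewrite n0E => /oppr_inj/eqP; rewrite -subr_eq0 => /eqP e.
  by rewrite scalerBl addrAC.
have [|_ s11k] := ind s10 (s11 - k).
  move: e1; rewrite n1E => /oppr_inj/eqP; rewrite -subr_eq0 => /eqP e.
  by rewrite scalerBl addrA.
by move/eqP: kH; apply; lra.
Qed.
End FundamentalForms.

Lemma dot_selfadjoint (R : realType) (n : nat) (x0 x1 n0 n1 : 'rV[R]_n)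
    (a b c d : R) : dot n0 x1 = dot n1 x0 ->
  dot (a *: n0 + b *: n1) (c *: x0 + d *: x1) =
  dot (c *: n0 + d *: n1) (a *: x0 + b *: x1).
Proof.
move=> sym; rewrite !dotE sym.
by move: (dot n0 x0) (dot n1 x0) (dot n1 x1) => d1 d2 d3; ring.
Qed.

Section PrincipalFrameExistence.
Variables (R : realType) (V : normedModType R) (w0 w1 : V).
Variables (D : set V) (X N : V -> 'rV[R]_3) (H : R) (K : V -> R).
Variable (sp : surface_patch w0 w1 D X N H K).

Let oD := patch_open sp.
Let sX := patch_X sp.
Let sN := patch_N sp.
Local Notation X0 := (pderiv w0 X).
Local Notation X1 := (pderiv w1 X).
Local Notation N0 := (pderiv w0 N).
Local Notation N1 := (pderiv w1 N).

Let sX0 : CinfV D X0. Proof. exact: CinfV_pderiv. Qed.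
Let sX1 : CinfV D X1. Proof. exact: CinfV_pderiv. Qed.
Let sN0 : CinfV D N0. Proof. exact: CinfV_pderiv. Qed.
Let sN1 : CinfV D N1. Proof. exact: CinfV_pderiv. Qed.

(** Both sides equal minus the product of [N] with a mixed second derivative of [X]. *)
Lemma patch_selfadjoint u : D u -> dot (N0 u) (X1 u) = dot (N1 u) (X0 u).
Proof.
move=> Du.
rewrite {1}(pderiv0E w0 w1 N) (dot_lieV _ _ oD _ _ sN sX1 (patch_N1 sp) Du).
rewrite -(pderiv0E w0 w1) (pderiv_comm _ _ oD sX Du).
rewrite [in RHS](pderiv1E w0 w1 N) (dot_lieV _ _ oD _ _ sN sX0 (patch_N0 sp) Du).
by rewrite -(pderiv1E w0 w1).
Qed.

Lemma Cinf_form_coef kappa (Ni Xi Xj : V -> 'rV[R]_3) : Cinf D kappa ->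
  CinfV D Ni -> CinfV D Xi -> CinfV D Xj ->
  Cinf D (fun u => form_coef (kappa u) (Ni u) (Xi u) (Xj u)).
Proof.
move=> sk sNi sXi sXj.
exact: Cinf_add oD (Cinf_opp oD (Cinf_dot oD sNi sXj))
  (Cinf_opp oD (Cinf_mul oD sk (Cinf_dot oD sXi sXj))).
Qed.

(** A smooth eigenvalue different from [H] is simple, so [h - kappa g] has rank one and its kernel
    is spanned near [x] by a column of its adjugate, smooth in the point. The field is then
    normalized where it does not vanish. *)
Lemma principal_field (kappa : V -> R) (x : V) : Cinf D kappa ->
  (forall u, D u -> kappa u ^+ 2 - 2 * H * kappa u + K u = 0) ->
  (forall u, D u -> kappa u != H) -> D x ->
  exists E a b, [/\ open E, E `<=` D & E x] /\ [/\ Cinf E a, Cinf E b &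
    forall u, E u ->
      lieV w0 w1 a b N u = - (kappa u *: lieV w0 w1 a b X u) /\
      dot (lieV w0 w1 a b X u) (lieV w0 w1 a b X u) = 1].
Proof.
move=> sk kE kH Dx.
pose c00 u := form_coef (kappa u) (N0 u) (X0 u) (X0 u).
pose c01 u := form_coef (kappa u) (N0 u) (X0 u) (X1 u).
pose c11 u := form_coef (kappa u) (N1 u) (X1 u) (X1 u).
have s00 : Cinf D c00 by exact: Cinf_form_coef.
have s01 : Cinf D c01 by exact: Cinf_form_coef.
have s11 : Cinf D c11 by exact: Cinf_form_coef.
have c10E u : D u -> form_coef (kappa u) (N1 u) (X1 u) (X0 u) = c01 u.
  by move=> Du; apply: form_coef_sym; exact: patch_selfadjoint.
(* The columns of the adjugate of [h - kappa g] lie in its kernel. *)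
pose a0 (z0 z1 : R) := - (cst z0 * c01 + cst z1 * c11).
pose b0 (z0 z1 : R) := cst z0 * c00 + cst z1 * c01.
have a0E z0 z1 u : a0 z0 z1 u = - (z0 * c01 u + z1 * c11 u) by [].
have b0E z0 z1 u : b0 z0 z1 u = z0 * c00 u + z1 * c01 u by [].
have cx : ~ [/\ c00 x = 0, c01 x = 0 & c11 x = 0].
  have [s00' [s01' [s10' [s11' [dN0 dN1 tr _]]]]] := patch_shape sp Dx.
  apply: (form_coef_neq0 dN0 dN1 tr (kH x Dx)) => [a b ab|].
    exact: (patch_indep sp Dx ab).
  exact: c10E.
(* If both columns, obtained for [(1, 0)] and [(0, 1)], vanished at [x], all entries of
   [h - kappa g] would vanish there. *)
have [z0 [z1 zP]] : exists z0 z1, ~ (a0 z0 z1 x = 0 /\ b0 z0 z1 x = 0).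
  apply: contrapT => /forallNP zN; apply: cx.
  have /forallNP/(_ 0)/contrapT [] := zN 1.
  have /forallNP/(_ 1)/contrapT [] := zN 0.
  rewrite !a0E !b0E; move: (c00 x) (c01 x) (c11 x) => d00 d01 d11.
  by rewrite !mul0r !mul1r !addr0 !add0r => /eqP; rewrite oppr_eq0 => /eqP.
pose a := a0 z0 z1; pose b := b0 z0 z1.
have sa : Cinf D a.
  apply: Cinf_opp => //; apply: Cinf_add => //;
  by apply: Cinf_mul => //; exact: Cinf_cst.
have sb : Cinf D b.
  by apply: Cinf_add => //; apply: Cinf_mul => //; exact: Cinf_cst.
pose n u := dot (lieV w0 w1 a b X u) (lieV w0 w1 a b X u).
have sn : Cinf D n by apply: Cinf_dot => //; exact: CinfV_lieV.
pose E := [set u | D u /\ n u != 0].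
have ED : E `<=` D by move=> u [].
have oE : open E by exact: open_neq0.
have n0 u : E u -> 0 < n u by move=> [_ nu0]; rewrite lt_neqAle eq_sym nu0 dot_ge0.
have Ex : E x.
  split=> //; apply/eqP => /dot_eq0; rewrite lieVE => ab.
  by apply: zP; exact: (patch_indep sp Dx ab).
pose r u := (Num.sqrt (n u))^-1.
have sr : Cinf E r.
  apply: Cinf_inv oE _ (Cinf_sqrt oE n0 (Cinf_sub ED sn)) => u Eu.
  by rewrite gt_eqF// sqrtr_gt0 n0.
have lier F u : lieV w0 w1 (r * a) (r * b) F u = r u *: lieV w0 w1 a b F u.
  by rewrite !lieVE !fctE scalerDr !scalerA.
exists E, (r * a), (r * b); split=> //; split.
- exact: Cinf_mul oE sr (Cinf_sub ED sa).
- exact: Cinf_mul oE sr (Cinf_sub ED sb).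
move=> u Eu; have Du := ED _ Eu; rewrite !lier; split; last first.
  rewrite dotZl dotZr mulrA -expr2 -/(n u) /r exprVn sqr_sqrtr ?ltW ?n0//.
  by rewrite mulVf// gt_eqF// n0.
rewrite scalerA [kappa u * _]mulrC -scalerA -scalerN; congr (_ *: _).
have [s00' [s01' [s10' [s11' [dN0 dN1 tr det]]]]] := patch_shape sp Du.
have := form_det dN0 dN1 (patch_selfadjoint Du) tr det (kE u Du).
rewrite !lieVE -/(c00 u) -/(c01 u) -/(c11 u) => cdet.
apply: (principal_directionP dN0 dN1).
  rewrite c10E// -/(c00 u) /a /b a0E b0E.
  move: (c00 u) (c01 u) (c11 u) cdet => d00 d01 d11 cdet.
  by rewrite -[RHS](subrr (z1 * d01 ^+ 2)) -{2}cdet; ring.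
rewrite -/(c01 u) -/(c11 u) /a /b a0E b0E.
move: (c00 u) (c01 u) (c11 u) cdet => d00 d01 d11 cdet.
by rewrite -[RHS](subrr (z0 * d01 ^+ 2)) -{1}cdet; ring.
Qed.

Lemma principal_frame_exists (mu : V -> R) (x : V) : Cinf D mu ->
  (forall u, D u -> mu u != 0) ->
  (forall u, D u -> mu u ^+ 2 = H ^+ 2 - K u) -> D x ->
  exists E p1 q1 p2 q2, [/\ E `<=` D, E x &
    principal_frame w0 w1 E X N H mu p1 q1 p2 q2].
Proof.
move=> smu mu0 muE Dx.
have sH := Cinf_cst D H.
have [|u Du|u Du|E1 [p1 [q1 [[oE1 E1D E1x] [sp1 sq1 P1]]]]] :=
    @principal_field (cst H + mu) x _ _ _ Dx.
- exact: Cinf_add.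
- by have := muE u Du; rewrite !fctE; move: (mu u) => m e; nra.
- by rewrite !fctE -subr_eq0 addrAC subrr add0r mu0.
have [|u Du|u Du|E2 [p2 [q2 [[oE2 E2D E2x] [sp2 sq2 P2]]]]] :=
    @principal_field (cst H - mu) x _ _ _ Dx.
- by apply: Cinf_add => //; exact: Cinf_opp.
- by have := muE u Du; rewrite !fctE; move: (mu u) => m e; nra.
- by rewrite !fctE -subr_eq0 addrAC subrr add0r oppr_eq0 mu0.
have I1 : E1 `&` E2 `<=` E1 by move=> u [].
have I2 : E1 `&` E2 `<=` E2 by move=> u [].
have ID : E1 `&` E2 `<=` D by move=> u [/E1D].
exists (E1 `&` E2), p1, q1, p2, q2; split=> //.
have NT p q u : D u -> dot (lieV w0 w1 p q X u) (N u) = 0.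
  move=> Du; rewrite lieVE !dotE !(dotC _ (N u)) (patch_N0 sp Du) (patch_N1 sp Du).
  by rewrite !mulr0 addr0.
split.
- exact: openI.
- exact: CinfV_sub ID sX.
- exact: CinfV_sub ID sN.
- exact: Cinf_sub ID smu.
- exact: Cinf_sub I1 sp1.
- exact: Cinf_sub I1 sq1.
- exact: Cinf_sub I2 sp2.
- exact: Cinf_sub I2 sq2.
- by move=> u /ID/mu0.
- by move=> u a b /ID Du; rewrite lieVE => ab; exact: (patch_indep sp Du ab).
- by move=> u /ID Du; exact: patch_NN sp _ Du.
- by move=> u /I1/P1[].
- by move=> u /I2/P2[].
(* Orthogonality: eigenvectors of a self-adjoint operator for the distinct eigenvalues [H + mu] and
   [H - mu]. *)
- move=> u Iu; have Du := ID u Iu.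
  have [dN1 _] := P1 u (I1 u Iu); have [dN2 _] := P2 u (I2 u Iu).
  have sym := patch_selfadjoint Du.
  have : dot (lieV w0 w1 p1 q1 N u) (lieV w0 w1 p2 q2 X u)
     = dot (lieV w0 w1 p2 q2 N u) (lieV w0 w1 p1 q1 X u).
    by rewrite !lieVE; exact: dot_selfadjoint.
  rewrite dN1 dN2 !dotE (dotC (lieV w0 w1 p2 q2 X u)) !fctE.
  have := mu0 u Du; move: (mu u) (dot _ _) => m d m0 e.
  by apply/eqP; rewrite -(inj_eq (mulfI m0)) mulr0; apply/eqP; nra.
- by move=> u /ID; exact: NT.
- by move=> u /ID; exact: NT.
- by move=> u /I1/P1[].
- by move=> u /I2/P2[].
Qed.

End PrincipalFrameExistence.

Lemma surface_patch_sub (R : realType) (V : normedModType R) (w0 w1 : V)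
    (D E : set V) (X N : V -> 'rV[R]_3) (H : R) (K : V -> R) :
  E `<=` D -> open E -> surface_patch w0 w1 D X N H K ->
  surface_patch w0 w1 E X N H K.
Proof.
move=> ED oE [oD sX sN NN XN0 XN1 ind sh]; split=> //.
- exact: CinfV_sub ED sX.
- exact: CinfV_sub ED sN.
- by move=> u /ED/NN.
- by move=> u /ED/XN0.
- by move=> u /ED/XN1.
- by move=> u a b /ED; exact: ind.
- by move=> u /ED/sh.
Qed.

(** The operator [S - H] has zero trace and zero determinant, so its square is zero;
    self-adjointness then makes it vanish. *)
Lemma umbilic_shape (R : realType) (x0 x1 n0 n1 : 'rV[R]_3)
    (s00 s01 s10 s11 H : R) :
  n0 = - (s00 *: x0 + s01 *: x1) -> n1 = - (s10 *: x0 + s11 *: x1) ->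
  dot n0 x1 = dot n1 x0 -> s00 + s11 = 2 * H ->
  s00 * s11 - s01 * s10 = H ^+ 2 -> n0 = - (H *: x0) /\ n1 = - (H *: x1).
Proof.
move=> n0E n1E sym tr det.
have s11E : s11 = 2 * H - s00 by lra.
have nil : (s00 - H) ^+ 2 + s01 * s10 = 0.
  by move: det; rewrite s11E => det; lra.
pose y0 := n0 + H *: x0; pose y1 := n1 + H *: x1.
have y0E : y0 = - ((s00 - H) *: x0 + s01 *: x1).
  by rewrite /y0 n0E; apply/rowP => j; rewrite !mxE; ring.
have y1E : y1 = - (s10 *: x0 + (H - s00) *: x1).
  by rewrite /y1 n1E s11E; apply/rowP => j; rewrite !mxE; ring.
have ysym : dot y0 x1 = dot y1 x0 by rewrite /y0 /y1 !dotE sym (dotC x0).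
(* S - H is self-adjoint and nilpotent. *)
have z0 : (s00 - H) *: y0 + s01 *: y1 = 0.
  rewrite y0E y1E; apply/rowP => j; rewrite !mxE.
  by rewrite -[RHS](mulr0 (- x0 0 j)) -nil; ring.
have z1 : s10 *: y0 + (H - s00) *: y1 = 0.
  rewrite y0E y1E; apply/rowP => j; rewrite !mxE.
  by rewrite -[RHS](mulr0 (- x1 0 j)) -nil; ring.
have [y00 y10] : y0 = 0 /\ y1 = 0.
  clearbody y0 y1; split; apply: dot_eq0.
    rewrite {2}y0E !dotE ysym.
    by have := congr1 (fun z => dot z x0) z0; rewrite /= !dotE => ->; rewrite oppr0.
  rewrite {2}y1E !dotE -ysym.
  by have := congr1 (fun z => dot z x1) z1; rewrite /= !dotE => ->; rewrite oppr0.
by split; apply/eqP; rewrite -addr_eq0; apply/eqP.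
Qed.

(** * Umbilic and non-umbilic patches of solitons *)

Section PatchConsequences.
Variables (R : realType) (V : normedModType R) (w0 w1 : V).
Variable (span : forall w : V, exists a b : R, w = a *: w0 + b *: w1).

Lemma derive0_ball (D : set V) (h : V -> R) (x : V) (r : R) :
  Cinf D h -> ball x r `<=` D ->
  (forall u, ball x r u -> 'D_w0 h u = 0 /\ 'D_w1 h u = 0) ->
  forall u, ball x r u -> h u = h x.
Proof.
move=> sh bD h0 u xu; apply: derive_eq0_cst xu => [y xy|y w xy].
  exact: Cinf_differentiable sh (bD _ xy).
have dh := Cinf_differentiable sh (bD _ xy).
have [a [b ->]] := span w; have [+ +] := h0 y xy.
rewrite !deriveE// => e0 e1.
by rewrite linearD !linearZ /= e0 e1 !scaler0 addr0.
Qed.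

Lemma pderiv0_ball (n : nat) (D : set V) (F : V -> 'rV[R]_n) (x : V) (r : R) :
  CinfV D F -> ball x r `<=` D ->
  (forall u, ball x r u -> pderiv w0 F u = 0 /\ pderiv w1 F u = 0) ->
  forall u, ball x r u -> F u = F x.
Proof.
move=> sF bD F0 u xu; apply/rowP => j.
apply: (derive0_ball (sF j) bD _ xu) => y xy.
by have [/rowP/(_ j) + /rowP/(_ j)] := F0 y xy; rewrite !mxE.
Qed.

Lemma derive_dot_cst (n : nat) (D : set V) (F : V -> 'rV[R]_n) (c : 'rV[R]_n)
    (w u : V) : open D -> CinfV D F -> D u ->
  'D_w (fun x => dot (F x) c) u = dot (pderiv w F u) c.
Proof.
move=> oD sF Du.
have := lie_dot w w oD (cst 1) (cst 0) sF (CinfV_cst D c) Du.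
rewrite lieV_cst dot0r addr0 lieE lieVE /cst mul1r mul0r addr0.
by rewrite scale1r scale0r addr0.
Qed.

Variables (D : set V) (X N : V -> 'rV[R]_3) (H : R) (K : V -> R).
Variable (sp : surface_patch w0 w1 D X N H K).

Let oD := patch_open sp.

(** The two tangent vectors and [N] are the rows of an invertible matrix, and that matrix kills
    [w]. *)
Lemma patch_span u w : D u -> dot (pderiv w0 X u) w = 0 ->
  dot (pderiv w1 X u) w = 0 -> dot (N u) w = 0 -> w = 0.
Proof.
move=> Du.
have := patch_N1 sp Du; have := patch_N0 sp Du; have := patch_NN sp Du.
have := fun a b => @patch_indep _ _ _ _ _ _ _ _ _ sp u a b Du.
move: (pderiv w0 X u) (pderiv w1 X u) (N u) => x0 x1 n ind nn nx0 nx1 d0 d1 dn.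
pose e (i : 'I_3) := if i == 0 then x0 else if i == 1 then x1 else n.
pose M : 'M[R]_3 := \matrix_(i, j) e i 0 j.
have Mfree : row_free M.
  apply: inj_row_free => z zM.
  have zE : z 0 0 *: x0 + z 0 1 *: x1 + z 0 (lift ord0 (lift ord0 ord0)) *: n = 0.
    rewrite -zM; apply/rowP => j; rewrite !mxE !big_ord_recl big_ord0 addr0 !mxE addrA.
    by congr (z 0 _ * _ + z 0 _ * _ + z 0 _ * _); apply/val_inj.
  have z2 : z 0 (lift ord0 (lift ord0 ord0)) = 0.
    by have := congr1 (dot n) zE; rewrite /= !dotE nx0 nx1 nn !mulr0 !add0r mulr1.
  have [|z00 z01] := ind (z 0 0) (z 0 1).
    by rewrite -[RHS]zE z2 scale0r addr0.
  apply/rowP => i; rewrite mxE; case: i => [[|[|[|//]]] i3].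
  - by rewrite -[RHS]z00; congr (z 0 _); exact/val_inj.
  - by rewrite -[RHS]z01; congr (z 0 _); exact/val_inj.
  - by rewrite -[RHS]z2; congr (z 0 _); exact/val_inj.
have Munit : M \in unitmx by rewrite -row_free_unit.
have Mw : M *m w^T = 0.
  apply/colP => i; rewrite !mxE.
  rewrite (_ : \sum_j _ = dot (e i) w); last first.
    by apply: eq_bigr => j _; rewrite !mxE.
  by rewrite /e; case: ifP => // _; case: ifP.
by apply: trmx_inj; rewrite trmx0 -[LHS](mulKmx Munit) Mw mulmx0.
Qed.

Lemma patch_umbilic u : (forall u, D u -> K u = H ^+ 2) -> D u ->
  pderiv w0 N u = - (H *: pderiv w0 X u) /\ pderiv w1 N u = - (H *: pderiv w1 X u).
Proof.
move=> KH Du; have [s00 [s01 [s10 [s11 [dN0 dN1 tr det]]]]] := patch_shape sp Du.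
apply: umbilic_shape dN0 dN1 (patch_selfadjoint sp Du) tr _.
by rewrite det KH.
Qed.

Variables (v : 'rV[R]_3) (lambda : R).
Variable (sol : forall u, D u -> K u = dot (N u) v + lambda).

(** The soliton equation writes [K] through [N], so [H ^ 2 - K] is smooth. Where it is positive, its
    square root is a smooth [mu], and a principal frame exists. *)
Lemma patch_flat x : (forall u, D u -> 0 <= H ^+ 2 - K u) -> D x ->
  K x != H ^+ 2 -> K x = 0.
Proof.
move=> HK Dx KxH.
pose G : V -> R := cst (H ^+ 2) - ((fun u => dot (N u) v) + cst lambda).
have GE u : D u -> G u = H ^+ 2 - K u by move=> Du; rewrite (sol Du).
have sG : Cinf D G.
  apply: Cinf_add => //; first exact: Cinf_cst.
  apply: Cinf_opp => //; apply: Cinf_add => //; last exact: Cinf_cst.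
  by apply: Cinf_dot => //; [exact: patch_N sp|exact: CinfV_cst].
pose E := [set u | D u /\ G u != 0].
have ED : E `<=` D by move=> u [].
have oE : open E by exact: open_neq0.
have G0 u : E u -> 0 < G u.
  by move=> [Du Gu]; rewrite lt_neqAle eq_sym Gu GE// HK.
pose mu u := Num.sqrt (G u).
have smu : Cinf E mu := Cinf_sqrt oE G0 (Cinf_sub ED sG).
have muE u : E u -> mu u ^+ 2 = H ^+ 2 - K u.
  by move=> Eu; rewrite /mu (sqr_sqrtr (ltW (G0 u Eu))); exact: GE (ED _ Eu).
have mu0 u : E u -> mu u != 0 by move=> Eu; rewrite gt_eqF// sqrtr_gt0 G0.
have Ex : E x by split=> //; rewrite GE// subr_eq0 eq_sym.
have [F [p1 [q1 [p2 [q2 [FE Fx fr]]]]]] :=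
  principal_frame_exists (surface_patch_sub ED oE sp) smu mu0 muE Ex.
have [u Fu||] := @soliton_frame_flat _ _ _ _ _ _ _ lambda v _ _ _ _ _ _ x fr => //.
  by have Eu := FE u Fu; rewrite (muE u Eu) subKr; exact: sol (ED u Eu).
by rewrite muE// => h _ _; lra.
Qed.

Lemma patch_umbilic_minimal x : dot v v = 1 ->
  (forall u, D u -> K u = H ^+ 2) -> D x -> H = 0.
Proof.
move=> vv KH Dx; apply/eqP; apply: contraT => H0.
have cN u : D u -> dot (N u) v = H ^+ 2 - lambda.
  by move=> Du; have := sol Du; rewrite KH// => ->; rewrite addrK.
have dN0 w u : D u -> dot (pderiv w N u) v = 0.
  move=> Du; rewrite -(derive_dot_cst _ _ oD (patch_N sp) Du).
  rewrite (@derive_eqon _ _ D _ (cst (H ^+ 2 - lambda))) ?derive_cst//.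
  by move=> y; rewrite inE => /cN.
have tan u : D u -> dot (pderiv w0 X u) v = 0 /\ dot (pderiv w1 X u) v = 0.
  move=> Du; have [e0 e1] := patch_umbilic KH Du.
  have := dN0 w1 u Du; have := dN0 w0 u Du; rewrite e0 e1 !dotNl !dotZl.
  move=> /eqP; rewrite oppr_eq0 mulf_eq0 (negPf H0) => /eqP -> /eqP.
  by rewrite oppr_eq0 mulf_eq0 (negPf H0) => /eqP.
have vN u : D u -> v = (H ^+ 2 - lambda) *: N u.
  move=> Du; apply/eqP; rewrite -subr_eq0; apply/eqP.
  have [t0 t1] := tan u Du.
  apply: (patch_span Du); rewrite !dotE ?t0 ?t1 ?(patch_NN sp Du) ?cN//.
  - by rewrite (dotC _ (N u)) (patch_N0 sp Du) mulr0 oppr0 addr0.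
  - by rewrite (dotC _ (N u)) (patch_N1 sp Du) mulr0 oppr0 addr0.
  - by rewrite mulr1 subrr.
(* As [v] is a unit vector it is not the zero multiple of [N]; so [N] is a fixed multiple of [v]. *)
have c0 : H ^+ 2 - lambda != 0.
  by apply/eqP => c0; move: vv; rewrite (vN x Dx) c0 scale0r dot0l => /eqP; rewrite eq_sym oner_eq0.
have Ncst : {in D, N =1 cst ((H ^+ 2 - lambda)^-1 *: v)}.
  by move=> u; rewrite inE => Du; rewrite [in RHS](vN u Du) /cst scalerA mulVf// scale1r.
have [] := patch_umbilic KH Dx.
rewrite (pderiv0E w0 w1) (lieV_eqon w0 w1 oD _ _ Ncst Dx) lieV_cst.
move=> /esym/eqP; rewrite oppr_eq0 scaler_eq0 (negPf H0) => /eqP X00 _.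
have [|/eqP] := @patch_indep _ _ _ _ _ _ _ _ _ sp x 1 0 Dx.
  by rewrite scale1r scale0r addr0.
by rewrite oner_eq0.
Qed.

End PatchConsequences.

(** * Local models: plane and cylinder *)

Section LocalModels.
Variables (R : realType) (V : normedModType R) (w0 w1 : V).
Variable (span : forall w : V, exists a b : R, w = a *: w0 + b *: w1).
Variables (D : set V) (X N : V -> 'rV[R]_3).

(** With [H = 0] and [K = 0] the patch is umbilic with zero shape operator: [N] is constant on a
    ball, and the height over the tangent plane at [x] has zero derivatives. *)
Lemma patch_plane (K : V -> R) x : surface_patch w0 w1 D X N 0 K ->
  (forall u, D u -> K u = 0) -> D x ->
  exists2 r : R, 0 < r & forall u, ball x r u ->
    [/\ D u, N u = N x & dot (X u) (N x) = dot (X x) (N x)].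
Proof.
move=> sp K0 Dx; have oD := patch_open sp.
have [r /= r0 rD] := (nbhs_ballP _ _).1 (open_nbhs_nbhs (conj oD Dx)).
exists r => // u xu.
have Ncst y : ball x r y -> N y = N x.
  apply: (pderiv0_ball span (patch_N sp) rD) => {}y xy.
  have KH z : D z -> K z = 0 ^+ 2 by move=> Dz; rewrite expr0n K0.
  have [-> ->] := patch_umbilic sp KH (rD _ xy).
  by rewrite !scale0r oppr0.
split; [exact: rD|exact: Ncst|].
have sXN : Cinf D (fun y => dot (X y) (N x)).
  by apply: Cinf_dot => //; [exact: patch_X sp|exact: CinfV_cst].
apply: (derive0_ball span sXN rD) xu => y xy; have Dy := rD _ xy.
rewrite !(derive_dot_cst _ _ oD (patch_X sp) Dy).
by rewrite -(Ncst y xy) !(dotC _ (N y)) (patch_N0 sp Dy) (patch_N1 sp Dy).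
Qed.

(** The frame coefficients form an invertible matrix, as otherwise the second frame vector would be
    zero; so vanishing along the frame implies vanishing along [w0] and [w1]. *)
Lemma frame_cst_ball (n : nat) (E : set V) (H : R) (mu p1 q1 p2 q2 : V -> R)
    (F : V -> 'rV[R]_n) (x : V) (r : R) :
  principal_frame w0 w1 E X N H mu p1 q1 p2 q2 -> CinfV E F -> ball x r `<=` E ->
  (forall u, ball x r u -> lieV w0 w1 p1 q1 F u = 0 /\ lieV w0 w1 p2 q2 F u = 0) ->
  forall u, ball x r u -> F u = F x.
Proof.
move=> fr sF rE F0; apply: (pderiv0_ball span sF rE) => u xu; have Eu := rE _ xu.
have [] := F0 u xu; rewrite !lieVE.
have := frame_11 fr Eu; have := frame_22 fr Eu; have := frame_12 fr Eu.
rewrite !lieVE.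
move: (p1 u) (q1 u) (p2 u) (q2 u) (pderiv w0 X u) (pderiv w1 X u).
move: (pderiv w0 F u) (pderiv w1 F u) => f0 f1 a b c d x0 x1 o12 o22 o11 e1 e2.
have det0 : a * d - b * c != 0.
  apply/eqP => det.
  have z1 : d *: (a *: x0 + b *: x1) - b *: (c *: x0 + d *: x1) = 0.
    by apply/rowP => j; rewrite !mxE -[RHS](mul0r (x0 0 j)) -det; ring.
  have z2 : c *: (a *: x0 + b *: x1) - a *: (c *: x0 + d *: x1) = 0.
    by apply/rowP => j; rewrite !mxE -[RHS](mul0r (- x1 0 j)) -det; ring.
  have dc (s t : R) : s *: (a *: x0 + b *: x1) - t *: (c *: x0 + d *: x1) = 0 -> s = 0.
    move=> /(congr1 (fun z => dot z (a *: x0 + b *: x1))).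
    move: o11 o12; move: (a *: x0 + b *: x1) (c *: x0 + d *: x1) => y1 y2 o11 o12.
    by rewrite /= !dotE (dotC y2) o11 o12 mulr1 mulr0 subr0.
  move: o22; rewrite (dc _ _ z1) (dc _ _ z2) !scale0r addr0 dot0l.
  by move/eqP; rewrite eq_sym oner_eq0.
split; apply/eqP.
  have : (a * d - b * c) *: f0 = d *: (a *: f0 + b *: f1) - b *: (c *: f0 + d *: f1).
    by apply/rowP => j; rewrite !mxE; ring.
  by rewrite e1 e2 !scaler0 subr0 => /eqP; rewrite scaler_eq0 (negPf det0).
have : (a * d - b * c) *: f1 = a *: (c *: f0 + d *: f1) - c *: (a *: f0 + b *: f1).
  by apply/rowP => j; rewrite !mxE; ring.
by rewrite e1 e2 !scaler0 subr0 => /eqP; rewrite scaler_eq0 (negPf det0).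
Qed.

(* Along the flat principal direction [T2] is constant and [X + N / 2H] moves on
   a line of that direction: the local model of a cylinder of axis [e0]. *)
Lemma patch_cylinder (H lambda : R) (v : 'rV[R]_3) (K : V -> R) x :
  surface_patch w0 w1 D X N H K -> H != 0 -> (forall u, D u -> K u = 0) ->
  (forall u, D u -> K u = dot (N u) v + lambda) -> D x ->
  exists2 r : R, 0 < r & exists2 e0, dot e0 e0 = 1 & forall u, ball x r u ->
    [/\ D u, dot (N u) e0 = 0,
     exists t : R, X u + (2 * H)^-1 *: N u = X x + (2 * H)^-1 *: N x + t *: e0 &
     forall e, (\forall y \near u, dot (N y) e = 0) -> exists s : R, e = s *: e0].
Proof.
move=> sp H0 K0 sol Dx; have oD := patch_open sp.
(* Since [K = 0], the constant [mu = H] is admissible, and the principal curvatures are [2 H] and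
   [0]. *)
have [|u Du|u Du|E [p1 [q1 [p2 [q2 [ED Ex fr]]]]]] :=
  principal_frame_exists sp (mu := cst H) _ _ _ Dx.
- exact: Cinf_cst.
- by [].
- by rewrite K0// subr0.
have oE := frame_open fr.
have flat u : E u -> frame_alpha w0 w1 X p1 q1 p2 q2 u = 0 /\
    frame_beta w0 w1 X p1 q1 p2 q2 u = 0.
  move=> Eu; have [y Ey|//|//] := @soliton_frame_flat _ _ _ _ _ _ _ lambda v _ _ _ _ _ _ u fr.
  by rewrite subrr -sol ?K0//; exact: ED.
have [r /= r0 rE] := (nbhs_ballP _ _).1 (open_nbhs_nbhs (conj oE Ex)).
pose T2 := lieV w0 w1 p2 q2 X.
have sX := frame_X fr; have sN := frame_N fr.
have sT2 : CinfV E T2 by case: fr => *; exact: CinfV_lieV.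
have T2cst u : ball x r u -> T2 u = T2 x.
  apply: (frame_cst_ball fr sT2 rE) => {}u xu; have Eu := rE _ xu.
  have [al0 be0] := flat u Eu.
  by rewrite (lie1_T2 fr Eu) (lie2_T2 fr Eu) al0 be0 subrr !scale0r oppr0 addr0.
have e00 : dot (T2 x) (T2 x) = 1 := frame_22 fr Ex.
have He : (2 * H)^-1 * (H + H) = 1 by field.
(* The centre of curvature of the curved direction: it is stationary along the first field and moves
   with velocity [T2] along the second. *)
pose C u := X u + (2 * H)^-1 *: N u.
have sC : CinfV E C.
  by apply: CinfV_add => //; apply: CinfV_scale => //; exact: Cinf_cst.
have lieC p q u : E u -> lieV w0 w1 p q C u =
    lieV w0 w1 p q X u + (2 * H)^-1 *: lieV w0 w1 p q N u.
  move=> Eu; have sc := Cinf_cst E ((2 * H)^-1).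
  rewrite (lieV_add _ _ _ _ sX (CinfV_scale oE sc sN) Eu).
  by rewrite (lieV_scale _ _ _ _ sc sN Eu) lie_cst scale0r add0r.
have C1 u : E u -> lieV w0 w1 p1 q1 C u = 0.
  move=> Eu; rewrite lieC// (frame_dN1 fr Eu) scalerN scalerA He scale1r.
  exact: subrr.
have C2 u : E u -> lieV w0 w1 p2 q2 C u = T2 u.
  by move=> Eu; rewrite lieC// (frame_dN2 fr Eu) subrr scale0r oppr0 scaler0 addr0.
(* [G] is [C] without its component along [T2 x]; it is constant, so [C] stays on a line. *)
pose G u := C u + dot (C u) (- T2 x) *: T2 x.
have se : CinfV E (cst (- T2 x)) by exact: CinfV_cst.
have sd : Cinf E (fun u => dot (C u) (- T2 x)) by exact: Cinf_dot.
have sc : CinfV E (cst (T2 x)) by exact: CinfV_cst.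
have sG : CinfV E G by apply: CinfV_add => //; exact: CinfV_scale.
have lieG p q u : E u -> lieV w0 w1 p q G u =
    lieV w0 w1 p q C u - dot (lieV w0 w1 p q C u) (T2 x) *: T2 x.
  move=> Eu; rewrite (lieV_add _ _ _ _ sC (CinfV_scale oE sd sc) Eu).
  rewrite (lieV_scale _ _ _ _ sd sc Eu) (lie_dot _ _ oE _ _ sC se Eu) !lieV_cst.
  by rewrite dot0r scaler0 !addr0 dotNr scaleNr.
have Gcst u : ball x r u -> G u = G x.
  apply: (frame_cst_ball fr sG rE) => {}u xu; have Eu := rE _ xu.
  rewrite !lieG// C1// C2// T2cst// e00 dot0l scale0r scale1r.
  by rewrite !subrr.
exists r => //; exists (T2 x) => // u xu; have Eu := rE _ xu; split.
- exact: ED.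
- by rewrite -(T2cst u xu) dotC (frame_2N fr Eu).
- exists (dot (C u) (T2 x) - dot (C x) (T2 x)).
  have := Gcst u xu; rewrite /G !dotNr !scaleNr => Gu.
  rewrite -/(C u) -/(C x) -[LHS](subrK (dot (C u) (T2 x) *: T2 x)) Gu.
  by rewrite scalerBl addrA [LHS]addrAC.
(* Uniqueness of the axis direction, needed to match neighbouring charts: differentiating
   [<N, e> = 0] along the first field gives [2 H <T1, e> = 0], so [e] is parallel to [T2]. *)
move=> e eN.
have Ne : dot (N u) e = 0 by exact: (nbhs_singleton eN).
have [F oF FN] : exists2 F, open_nbhs u F & F `<=` [set y | dot (N y) e = 0].
  by have : nbhs u [set y | dot (N y) e = 0] by []; rewrite nbhsE.
have EF_E : E `&` F `<=` E by move=> y [].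
have oEF : open (E `&` F) by apply: openI => //; case: oF.
have EFu : (E `&` F) u by split=> //; case: oF.
have T1e : dot (lieV w0 w1 p1 q1 X u) e = 0.
  have ND y : (E `&` F) y -> dot (N y) (cst e y) = 0 by move=> [_ /FN].
  have := dot_lieV w0 w1 oEF p1 q1 (CinfV_sub EF_E sN) (CinfV_cst _ e) ND EFu.
  rewrite lieV_cst dot0r oppr0 (frame_dN1 fr Eu) dotNl dotZl => /eqP.
  rewrite oppr_eq0 mulf_eq0 => /orP[|/eqP//].
  by rewrite -mulr2n mulrn_eq0 (negPf H0).
exists (dot e (T2 u)); rewrite -(T2cst u xu).
rewrite [LHS](orthonormal_expand e (frame_11 fr Eu) (frame_22 fr Eu) (frame_NN fr Eu)
  (frame_12 fr Eu) (frame_1N fr Eu) (frame_2N fr Eu)).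
by rewrite -/T2 (dotC e) T1e (dotC e (N u)) Ne !scale0r add0r addr0.
Qed.

End LocalModels.

(** * Nearest points *)

Lemma dot_sub_le (R : realType) (n : nat) (x y : 'rV[R]_n) :
  dot (x - y) (x - y) <= 2 * dot x x + 2 * dot y y.
Proof.
have := dot_ge0 (x + y); rewrite !dotE (dotC y x).
by move: (dot x x) (dot x y) (dot y y) => a b c; lra.
Qed.

Section NearestPoint.
Variables (R : realType) (m n : nat).
Implicit Types (u w : 'rV[R]_m.+1).

Let norm_sub_continuous (u0 u : 'rV[R]_m.+1) : 
  {for u, continuous (fun x : 'rV[R]_m.+1 => `|x - u0|)}.
Proof.
apply: continuous_comp; last exact: norm_continuous.
by apply: (@continuousB _ _ _ id (cst u0)) => //; exact: cst_continuous.
Qed.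

Let sphere_min (u0 : 'rV[R]_m.+1) (d : R) (g : 'rV[R]_m.+1 -> R) : 0 < d ->
  (forall u, `|u - u0| = d -> {for u, continuous g}) ->
  (forall u, `|u - u0| = d -> 0 < g u) ->
  exists2 c : R, 0 < c & forall u, `|u - u0| = d -> c <= g u.
Proof.
move=> d0 cg g0; pose S := [set u | `|u - u0| = d].
have cS : compact S.
  apply: bounded_closed_compact.
    exists (`|u0| + d); split; first exact: num_real.
    move=> M uM u /= ud; apply: le_trans (ltW uM).
    by rewrite -[u](subrK u0) (le_trans (ler_normD _ _))// ud addrC.
  rewrite /S (_ : [set u | _] = (fun u => `|u - u0|) @^-1` [set d])//.
  apply: closed_comp; last exact: closed_eq.
  by move=> u _; exact: norm_sub_continuous.
have S0 : S !=set0.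
  pose w : 'rV[R]_m.+1 := delta_mx 0 0.
  have w0 : `|w| != 0.
    rewrite normr_eq0; apply/eqP => /matrixP/(_ 0 0); rewrite !mxE !eqxx => /eqP.
    by rewrite oner_eq0.
  exists ((d / `|w|) *: w + u0); rewrite /S /= addrK normrZ normf_div normr_id.
  by rewrite divfK// gtr0_norm.
have [|c /set_mem Sc cmin] := EVT_min_rV S0 cS (f := g).
  apply: continuous_in_subspaceT => u /set_mem Su; exact: cg.
by exists (g c); [exact: g0|move=> u Su; apply: cmin; rewrite inE].
Qed.

(** By compactness of the unit sphere, the differential is bounded below by [c |w|], while the
    first-order remainder is at most [(c / 2) |h|] near [0]. *)
Lemma injective_diff_neq (X : 'rV[R]_m.+1 -> 'rV[R]_n) (u0 : 'rV[R]_m.+1) :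
  differentiable X u0 -> injective ('d X u0) ->
  \forall h \near (0 : 'rV[R]_m.+1), X (h + u0) = X u0 -> h = 0.
Proof.
move=> dX injX.
have [||c c0 cP] := @sphere_min 0 1 (fun w => `|'d X u0 w|) ltr01.
- move=> u _; apply: continuous_comp; last exact: norm_continuous.
  exact: diff_continuous.
- move=> u u1; rewrite normr_gt0; apply/eqP => dXu.
  have u00 : u = 0 by apply: injX; rewrite dXu linear0.
  by move: u1; rewrite u00 subr0 normr0 => /eqP; rewrite eq_sym oner_eq0.
have lower w : c * `|w| <= `|'d X u0 w|.
  have [->|w0] := eqVneq w 0; first by rewrite normr0 mulr0.
  have nw : `|w| != 0 by rewrite normr_eq0.
  have := cP (`|w|^-1 *: w); rewrite subr0 linearZ /= !normrZ normfV normr_id mulVf//.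
  by move=> /(_ erefl); rewrite mulrC ler_pdivlMr// normr_gt0.
have c2 : 0 < c / 2 by rewrite divr_gt0.
have /eqaddoP/(_ _ c2) := diff_locally dX.
apply: filterS => h; rewrite !fctE /= => hX Xh.
rewrite Xh opprD addrA subrr add0r normrN in hX.
apply/eqP; rewrite -normr_le0 -(ler_pM2l c2) mulr0.
by have := le_trans (lower h) hX; lra.
Qed.

(* Minimize the Euclidean distance to [y] over a small closed ball on whose
   boundary [X] stays away from [X u0]. *)
Lemma nearest_point_normal (D : set 'rV[R]_m.+1) (X : 'rV[R]_m.+1 -> 'rV[R]_n)
    (u0 : 'rV[R]_m.+1) : open D -> CinfV D X -> D u0 ->
  differentiable X u0 -> injective ('d X u0) ->
  exists2 e : R, 0 < e & forall y, dot (X u0 - y) (X u0 - y) < e ->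
    exists u, [/\ D u, dot (X u - y) (X u - y) <= dot (X u0 - y) (X u0 - y) &
      forall w, dot (pderiv w X u) (X u - y) = 0].
Proof.
move=> oD sX Du0 dX injX.
have inD : \forall h \near (0 : 'rV[R]_m.+1), D (h + u0).
  have : \forall x \near u0, D x by exact: open_nbhs_nbhs.
  by rewrite (near_shift 0 u0) subr0.
have [r /= r0 rP] := (nbhs_ballP _ _).1 (filterI (injective_diff_neq dX injX) inD).
have {}rP u : `|u - u0| < r -> (X u = X u0 -> u = u0) /\ D u.
  move=> ur; have [|P1 P2] := rP (u - u0).
    by rewrite -ball_normE /= sub0r normrN.
  move: P1 P2; rewrite /= subrK => P1 P2; split=> // /P1 /eqP.
  by rewrite subr_eq0 => /eqP.
pose d := r / 2; have d0 : 0 < d by rewrite divr_gt0.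
have dr : d < r by rewrite /d; lra.
have sXy y : CinfV D (fun u => X u - y).
  by apply: CinfV_add => //; exact: CinfV_cst.
have sphi y : Cinf D (fun u => dot (X u - y) (X u - y)) by exact: Cinf_dot.
have [||c c0 cP] := @sphere_min u0 d (fun u => dot (X u - X u0) (X u - X u0)) d0.
- move=> u ud; apply: Cinf_continuous (sphi _) _.
  by have [] := rP u; rewrite ?ud.
- move=> u ud; apply: dot_gt0; rewrite subr_eq0; apply/eqP => Xu.
  have ur : `|u - u0| < r by rewrite ud.
  have uu0 := (rP u ur).1 Xu.
  by move: ud; rewrite uu0 subrr normr0 => /eqP; rewrite eq_sym gt_eqF.
(* A minimizer [u] on the boundary would have both [X u] and [X u0] at squared distance less than
   [c / 4] from [y], hence at squared distance less than [c] from each other by [dot_sub_le],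
   against the choice of [c]. *)
exists (c / 4); first by rewrite divr_gt0.
move=> y yc.
pose B := [set u | `|u - u0| <= d].
have cB : compact B.
  apply: bounded_closed_compact.
    exists (`|u0| + d); split; first exact: num_real.
    move=> M uM u /= ud; apply: le_trans (ltW uM).
    by rewrite -[u](subrK u0) (le_trans (ler_normD _ _))// addrC lerD2l.
  rewrite /B (_ : [set u | _] = (fun u => `|u - u0|) @^-1` [set x | x <= d])//.
  apply: closed_comp; last exact: closed_le.
  by move=> u _; exact: norm_sub_continuous.
have B0 : B !=set0 by exists u0; rewrite /B /= subrr normr0 ltW.
have BD u : B u -> D u by move=> ud; have [] := rP u (le_lt_trans ud dr).
have [|u /set_mem Bu umin] := EVT_min_rV B0 cB (f := fun u => dot (X u - y) (X u - y)).
  apply: continuous_in_subspaceT => u /set_mem Bu.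
  by apply: Cinf_continuous (sphi y) _; exact: BD.
have uu0 : dot (X u - y) (X u - y) <= dot (X u0 - y) (X u0 - y).
  by apply: umin; rewrite inE /B /= subrr normr0 ltW.
have uc := le_lt_trans uu0 yc.
have ud : `|u - u0| < d.
  rewrite lt_neqAle Bu andbT; apply/eqP => ud; have := cP u ud.
  have -> : X u - X u0 = (X u - y) - (X u0 - y) by rewrite opprB addrA subrK.
  have := dot_sub_le (X u - y) (X u0 - y).
  by move: (dot _ _) (dot _ _) (dot _ _) yc uc => a b b'; lra.
exists u; split=> //; first exact: BD.
move=> w; have Du : D u := BD u Bu.
have pE : pderiv w (fun x => X x - y) u = pderiv w X u.
  rewrite !(pderiv0E w w) (lieV_add w w _ _ sX (CinfV_cst D (- y)) Du).
  by rewrite lieV_cst addr0.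
have Dphi : 'D_w (fun x => dot (X x - y) (X x - y)) u = 2 * dot (pderiv w X u) (X u - y).
  have := lie_dot w w oD (cst 1) (cst 0) (sXy y) (sXy y) Du.
  rewrite lieE lieVE pE /cst mul1r mul0r addr0 scale1r scale0r addr0 => ->.
  by rewrite (dotC (X u - y)) mulr_natl mulr2n.
have bu t : `|t| * (`|w| + 1) < d - `|u - u0| -> `|t *: w + u - u0| < d.
  move=> tw; rewrite -addrA (le_lt_trans (ler_normD _ _))// -ltrBrDr normrZ.
  by rewrite (le_lt_trans _ tw)// ler_wpM2l// lerDl.
(* For parameters below [b] in absolute value the line through [u] in direction [w] stays in the
   open ball, so the interior minimum is critical along it. *)
pose b := (d - `|u - u0|) / (`|w| + 1).
have w1 : 0 < `|w| + 1 by rewrite ltr_wpDl.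
have b0 : 0 < b by rewrite divr_gt0// subr_gt0.
have tb t : t \in `]- b, b[%R -> `|t *: w + u - u0| < d.
  rewrite in_itv /= => tb; apply: bu; rewrite -ltr_pdivlMr// ltr_norml.
  by move: tb.
have Dt t : t \in `]- b, b[%R -> D (t *: w + u).
  by move=> /tb/ltW; exact: BD.
have dline t : t \in `]- b, b[%R ->
    is_derive t 1 (fun s : R => (fun x => dot (X x - y) (X x - y)) (s *: w + u))
      ('D_w (fun x => dot (X x - y) (X x - y)) (t *: w + u)).
  by move=> /Dt Dtu; apply: is_derive_line; exact: Cinf_differentiable (sphi y) Dtu.
have z0 : (0 : R) \in `]- b, b[%R by rewrite in_itv /= oppr_lt0 b0.
have b2 : - b <= b by lra.
pose f (s : R) := dot (X (s *: w + u) - y) (X (s *: w + u) - y).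
have fmin : is_derive (0 : R) 1 f 0.
  apply: (@derive1_at_min R f (- b) b 0 b2) => // t tI.
    exact: (@ex_derive _ _ _ _ _ _ _ (dline t tI)).
  by rewrite {1}/f scale0r add0r; apply: umin; rewrite inE; exact/ltW/tb.
have f0 := @derive_val _ _ _ _ _ _ _ (dline 0 z0).
rewrite scale0r add0r Dphi in f0.
have f0' := @derive_val _ _ _ _ _ _ _ fmin.
have /eqP : 2 * dot (pderiv w X u) (X u - y) = 0 by rewrite -f0.
by rewrite mulf_eq0 pnatr_eq0 => /eqP.
Qed.

End NearestPoint.

(** * Surfaces *)

Lemma Cn_Ck (R : realType) (m n k : nat) (D : set 'rV[R]_m.+1)
    (f : 'rV[R]_m.+1 -> 'rV[R]_n.+1) (j : 'I_n.+1) : open D -> Cn k D f ->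
  Ck k D (fun u => f u 0 j).
Proof.
move=> oD; elim: k f => [|k IH] f /=.
  move=> cf u Du.
  apply: (@continuous_comp _ _ _ f (fun y : 'rV[R]_n.+1 => y 0 j) u (cf u Du)).
  exact: coord_continuous.
move=> [df Df]; split=> [u Du|w].
  apply: (@differentiable_comp _ _ _ _ f (fun y : 'rV[R]_n.+1 => y 0 j) u (df u Du)).
  exact: differentiable_coord.
apply: Ck_eqon oD _ (IH _ (Df w)) => u; rewrite inE => Du.
have dfw : derivable f u w by exact/diff_derivable/df.
by rewrite (derive_mx dfw) mxE.
Qed.

Lemma smooth_CinfV (R : realType) (m n : nat) (D : set 'rV[R]_m.+1)
    (f : 'rV[R]_m.+1 -> 'rV[R]_n.+1) : open D -> smooth D f -> CinfV D f.
Proof. by move=> oD sf j k; exact: Cn_Ck oD (sf k). Qed.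

Lemma pderivE (R : realType) (V : normedModType R) (n : nat)
    (F : V -> 'rV[R]_n) (w u : V) : differentiable F u -> pderiv w F u = 'd F u w.
Proof.
move=> dF; have dFw : derivable F u w by exact: diff_derivable.
rewrite -(deriveE w dF) (derive_mx dFw).
by apply/rowP => j; rewrite [LHS]mxE [RHS]mxE.
Qed.

Section ChartBasis.
Variable R : realType.

Definition ebasis (i : 'I_2) : 'rV[R]_2 := delta_mx 0 i.

Lemma ebasis_expand (w : 'rV[R]_2) : w = w 0 0 *: ebasis 0 + w 0 1 *: ebasis 1.
Proof.
rewrite [LHS]row_sum_delta !big_ord_recl big_ord0 addr0.
by congr (_ + w 0 _ *: delta_mx 0 _); exact/val_inj.
Qed.

Lemma ebasis_span (w : 'rV[R]_2) : exists a b : R, w = a *: ebasis 0 + b *: ebasis 1.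
Proof. by exists (w 0 0), (w 0 1); exact: ebasis_expand. Qed.

Lemma diff_ebasis (n : nat) (F : 'rV[R]_2 -> 'rV[R]_n) (u w : 'rV[R]_2) :
  differentiable F u ->
  'd F u w = w 0 0 *: pderiv (ebasis 0) F u + w 0 1 *: pderiv (ebasis 1) F u.
Proof.
move=> dF; rewrite !(pderivE _ dF) [in LHS](ebasis_expand w).
by rewrite linearD !linearZ.
Qed.

Lemma char_poly2 (S : 'M[R]_2) (a b : R) :
  char_poly S = ('X - a%:P) * ('X - b%:P) ->
  S 0 0 + S 1 1 = a + b /\ S 0 0 * S 1 1 - S 0 1 * S 1 0 = a * b.
Proof.
move=> cS.
have pE : ('X - a%:P) * ('X - b%:P) = 'X^2 - (a + b) *: 'X + (a * b)%:P.
  by rewrite -mul_polyC polyCD polyCM; ring.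
split.
  have := @char_poly_trace _ _ S isT; rewrite cS pE !coefE /= mulr1 sub0r addr0.
  move/oppr_inj => ->; rewrite /mxtrace !big_ord_recl big_ord0 addr0.
  by congr (S _ _ + S _ _); exact/val_inj.
have := char_poly_det S; rewrite cS pE !coefE /= mulr0 subr0 add0r sqrrN expr1n mul1r.
move=> ->; rewrite (expand_det_row _ 0) !big_ord_recl big_ord0 addr0.
rewrite /cofactor !det_mx11 !mxE /= expr0 expr1 mul1r mulN1r mulrN.
by congr (S _ _ * S _ _ - S _ _ * S _ _); exact/val_inj.
Qed.

End ChartBasis.

Lemma locally_constant_connected (T : topologicalType) (P : T -> Prop) :
  connected [set: T] -> (forall p, \forall q \near p, P q <-> P p) ->
  forall p q, P p -> P q.
Proof.
move=> cT lP p q Pp.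
have oP : open [set x | P x].
  rewrite openE => x Px; rewrite /interior /=.
  by apply: filterS (lP x) => y [_]; exact.
have oNP : open [set x | ~ P x].
  rewrite openE => x nPx; rewrite /interior /=.
  by apply: filterS (lP x) => y [yx _] /yx.
suff e : [set x | P x] = setT by have : [set: T] q by []; rewrite -e.
apply: cT; first by exists p.
  by exists [set x | P x] => //; rewrite setTI.
exists [set x | P x]; last by rewrite setTI.
by rewrite -[X in closed X]setCK; exact: open_closedC.
Qed.

Section Charts.
Variables (R : realType) (M : surface R).
Implicit Types (c : chart R M) (p : M).

Lemma near_chart c p (P : M -> Prop) : chart_dom c p ->
  (\forall u \near chart_map c p, P (chart_inv c u)) -> \forall q \near p, P q.
Proof.
move=> cp Pu; have := chart_map_continuous cp Pu.
rewrite /= => Pq; near=> q.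
rewrite -[q](@chart_mapK _ _ c); first by near: q.
by near: q; apply: open_nbhs_nbhs; split => //; exact: chart_dom_open.
Unshelve. all: by end_near. Qed.

Lemma chart_near c u (P : M -> Prop) : chart_cod c u ->
  (\forall q \near chart_inv c u, P q) -> \forall y \near u, P (chart_inv c y).
Proof. by move=> cu Pq; exact: (chart_inv_continuous cu Pq). Qed.

Variables (f N : M -> 'rV[R]_3) (k1 k2 : M -> R) (H : R).
Variables (hf : immersion f) (hN : gauss_map f N).
Variables (hk : principal_curvatures f N k1 k2).
Variables (hH : forall p, mean_curvature k1 k2 p = H).

Lemma chart_patch c : atlas c ->
  surface_patch (ebasis R 0) (ebasis R 1) (chart_cod c) (f \o chart_inv c)
    (N \o chart_inv c) H (gauss_curvature k1 k2 \o chart_inv c).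
Proof.
move=> ac; have [sf inj] := hf; have [sN NN Nf] := hN.
have oD := @chart_cod_open _ _ c.
have df u : chart_cod c u -> differentiable (f \o chart_inv c) u.
  by move=> cu; have [+ _] := sf c ac 1; exact.
have dN u : chart_cod c u -> differentiable (N \o chart_inv c) u.
  by move=> cu; have [+ _] := sN c ac 1; exact.
split => //.
- exact: smooth_CinfV (sf c ac).
- exact: smooth_CinfV (sN c ac).
- by move=> u cu; exact: NN.
- by move=> u cu; rewrite (pderivE _ (df u cu)); exact: Nf.
- by move=> u cu; rewrite (pderivE _ (df u cu)); exact: Nf.
- move=> u a b cu ab.
  have : 'd (f \o chart_inv c) u (a *: ebasis R 0 + b *: ebasis R 1) = 0.
    rewrite (diff_ebasis _ (df u cu)) -[RHS]ab !mxE /=.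
    by rewrite !(mulr1, mulr0, addr0, add0r).
  rewrite -(linear0 ('d (f \o chart_inv c) u)) => /(inj c u ac cu)/rowP w0.
  have := w0 0; have := w0 1; rewrite !mxE /= !(mulr1, mulr0, addr0, add0r).
  by [].
move=> u cu; have [S] := hk ac (chart_invP cu).
rewrite /shape_operator chart_invK// => shS /char_poly2 [tr det].
(* [S] acts on row vectors, so the image of a basis vector is a row of [S]. *)
exists (S 0 0), (S 0 1), (S 1 0), (S 1 1); split.
- rewrite (pderivE (ebasis R 0) (dN u cu)); apply: oppr_inj.
  rewrite -[LHS]shS opprK (diff_ebasis _ (df u cu)) -rowE ![row _ _ _ _]mxE.
  exact: erefl.
- rewrite (pderivE (ebasis R 1) (dN u cu)); apply: oppr_inj.
  rewrite -[LHS]shS opprK (diff_ebasis _ (df u cu)) -rowE ![row _ _ _ _]mxE.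
  exact: erefl.
- by rewrite tr -(hH (chart_inv c u)) /mean_curvature; field.
- exact: det.
Qed.

End Charts.

(** The topology comes from the sup norm; Euclidean balls are open because the squared distance is
    continuous. *)
Lemma open_dot_ball (R : realType) (n : nat) (a : 'rV[R]_n.+1) (e : R) :
  open [set y | dot (a - y) (a - y) < e].
Proof.
rewrite openE => y /= ye; rewrite /interior /=.
have cd : {for y, continuous (fun z : 'rV[R]_n.+1 => dot (a - z) (a - z))}.
  have sf j : {for y, continuous (fun z : 'rV[R]_n.+1 => (a - z) 0 j)}.
    rewrite (_ : (fun z => _) = (fun z : 'rV[R]_n.+1 => a 0 j - z 0 j)); last first.
      by apply/funext => z; rewrite !mxE.
    apply: (@continuousB _ _ _ (cst (a 0 j)) (fun z : 'rV[R]_n.+1 => z 0 j)).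
      exact: cst_continuous.
    exact: coord_continuous.
  rewrite (_ : (fun z => _) = \sum_j
      (fun z : 'rV[R]_n.+1 => (a - z) 0 j) * (fun z => (a - z) 0 j)).
    elim/big_rec: _ => [|j g _ IH]; first exact: cst_continuous.
    exact: (continuousD (continuousM (sf j) (sf j)) IH).
  by apply/funext => z; rewrite fct_sumE.
exact: (cvgr_lt _ cd _ ye).
Qed.

Lemma open_part_range (R : realType) (n : nat) (T : Type) (f : T -> 'rV[R]_n.+1)
    (Q : set 'rV[R]_n.+1) : (forall p, Q (f p)) ->
  (forall p, exists2 e : R, 0 < e &
    forall y, Q y -> dot (f p - y) (f p - y) < e -> range f y) ->
  open_part (range f) Q.
Proof.
move=> fQ fe.
(* The union of all Euclidean balls in which [Q] lies in the image; indexing by centre and radius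
   avoids choosing a radius for each point. *)
pose O := \bigcup_(b in [set b : 'rV[R]_n.+1 * R |
    forall y, Q y -> dot (b.1 - y) (b.1 - y) < b.2 -> range f y])
  [set y | dot (b.1 - y) (b.1 - y) < b.2].
exists O; first by apply: bigcup_open => b _; exact: open_dot_ball.
apply/seteqP; split=> [y [p _ <-]|y [Qy [b bP yb]]]; last exact: bP.
split; first exact: fQ.
have [e e0 eP] := fe p; exists (f p, e) => //=.
by rewrite subrr dot0l.
Qed.

(** * From charts to the whole surface *)

Section Classification.
Variables (R : realType) (M : surface R).
Variables (f N : M -> 'rV[R]_3) (k1 k2 : M -> R) (v : 'rV[R]_3) (lambda H : R).
Variables (hM : connected [set: M]) (hf : immersion f) (hN : gauss_map f N).
Variables (hk : principal_curvatures f N k1 k2) (hv : dot v v = 1).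
Variables (hsol : translating_soliton N k1 k2 v lambda).
Variables (hH : forall p, mean_curvature k1 k2 p = H).

Local Notation K := (gauss_curvature k1 k2).
Let patch c (ac : atlas c) := chart_patch hf hN hk hH ac.
Let span := @ebasis_span R.

Let NN p : dot (N p) (N p) = 1. Proof. by have [] := hN. Qed.

(** At the nearest point in a chart the difference is orthogonal to the tangent plane, hence a
    multiple of [N]; the bound on [t] is the minimality of the distance. *)
Lemma normal_projection p : exists2 e : R, 0 < e &
  forall y, dot (f p - y) (f p - y) < e ->
    exists q t, f q - y = t *: N q /\ t ^+ 2 <= dot (f p - y) (f p - y).
Proof.
have [c ac cp] := atlas_cover p; have sp := patch ac.
have cu := chart_mapP cp.
have [sf inj] := hf; have [df _] := sf c ac 1.
have [e e0 eP] := nearest_point_normal (patch_open sp) (patch_X sp) cu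
  (df _ cu) (inj c _ ac cu).
exists e => // y; have := eP y; rewrite /= (chart_mapK cp) => {}eP /eP.
move=> [u [Du uy un]]; exists (chart_inv c u).
pose t := dot (f (chart_inv c u) - y) (N (chart_inv c u)).
have E : f (chart_inv c u) - y = t *: N (chart_inv c u).
  apply/eqP; rewrite -subr_eq0; apply/eqP; apply: (patch_span sp Du).
  - rewrite dotDr un dotNr dotZr (dotC _ (N _)) [X in - (_ * X)](patch_N0 sp Du).
    by rewrite mulr0 subr0.
  - rewrite dotDr un dotNr dotZr (dotC _ (N _)) [X in - (_ * X)](patch_N1 sp Du).
    by rewrite mulr0 subr0.
  - by rewrite /= dotDr dotNr dotZr NN mulr1 dotC subrr.
exists t; split=> //; apply: le_trans uy.
by rewrite E dotZl dotZr NN mulr1 expr2.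
Qed.

(** The functions [k1] and [k2] are not assumed continuous; continuity of [K] comes from the soliton
    equation. *)
Lemma gauss_curvature_near_neq p (a : R) : K p != a -> \forall q \near p, K q != a.
Proof.
move=> Kp; have [c ac cp] := atlas_cover p; have sp := patch ac.
have cu := chart_mapP cp; apply: (near_chart cp).
have sK : Cinf (chart_cod c)
    ((fun u => dot ((N \o chart_inv c) u) v) + cst (lambda - a)).
  have sd := Cinf_dot (patch_open sp) (patch_N sp) (CinfV_cst (chart_cod c) v).
  exact: Cinf_add (patch_open sp) sd (Cinf_cst _ _).
have KE u : ((fun u => dot ((N \o chart_inv c) u) v) + cst (lambda - a)) u =
    K (chart_inv c u) - a.
  by rewrite hsol addrA.
have := Cinf_continuous sK cu; move=> /cvgr_neq0; rewrite KE chart_mapK// subr_eq0.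
by move=> /(_ Kp); apply: filterS => u; rewrite KE subr_eq0.
Qed.

Let HK p : 0 <= H ^+ 2 - K p.
Proof.
rewrite -(hH p) /mean_curvature /gauss_curvature.
rewrite (_ : _ - _ = ((k1 p - k2 p) / 2) ^+ 2) ?sqr_ge0//.
by field.
Qed.

Lemma gauss_curvature_dichotomy p : K p != H ^+ 2 -> K p = 0.
Proof.
move=> Kp; have [c ac cp] := atlas_cover p; have sp := patch ac.
have cu := chart_mapP cp.
have := @patch_flat _ _ _ _ _ _ _ _ _ sp v lambda _ (chart_map c p) _ cu.
rewrite /= chart_mapK//; apply => // u _ //=; exact: hsol.
Qed.

(** At each point [K] is [0] or [H ^ 2]. For nonzero [H] these values are distinct, so by continuity
    [K = 0] is a locally constant property; if it failed, the surface would be umbilic everywhere,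
    which [patch_umbilic_minimal] excludes. *)
Lemma gauss_curvature_eq0 p : K p = 0.
Proof.
have [H0|H0] := eqVneq H 0.
  by apply: contrapT => /eqP Kp; move: (Kp); rewrite gauss_curvature_dichotomy ?eqxx// H0 expr0n.
apply: contrapT => Kp.
have KH q : K q = H ^+ 2.
  apply: contrapT => /eqP Kq; apply: Kp; move: (gauss_curvature_dichotomy Kq).
  apply: (locally_constant_connected hM (P := fun q => K q = 0)) => x.
  have [Kx|Kx] := eqVneq (K x) 0.
    have : K x != H ^+ 2 by rewrite Kx eq_sym expf_neq0.
    move=> /gauss_curvature_near_neq; apply: filterS => y Ky.
    by split=> // _; exact: gauss_curvature_dichotomy.
  have := gauss_curvature_near_neq Kx; apply: filterS => y Ky.
  by split=> e; [move: Ky|move: Kx]; rewrite e eqxx.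
have [c ac cp] := atlas_cover p; have sp := patch ac.
have := @patch_umbilic_minimal _ _ _ _ _ _ _ _ _ sp v lambda _ (chart_map c p) hv.
move=> Hz; move/eqP: H0; apply; apply: Hz (chart_mapP cp) => u _ /=.
  exact: hsol.
exact: KH.
Qed.

Lemma minimal_soliton_plane (p0 : M) : H = 0 ->
  exists2 Q, is_plane Q & open_part (range f) Q.
Proof.
move=> H0.
pose P q := N q = N p0 /\ dot (f q) (N p0) = dot (f p0) (N p0).
have lP p : \forall q \near p, P q <-> P p.
  have [c ac cp] := atlas_cover p; have sp := patch ac; rewrite H0 in sp.
  have cu := chart_mapP cp; apply: (near_chart cp).
  have [r r0 rP] := patch_plane span sp (fun u _ => gauss_curvature_eq0 _) cu.
  apply: filterS (nbhsx_ballx (chart_map c p) r r0) => u /rP [_ /=].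
  rewrite (chart_mapK cp) /P => -> fu; split=> -[Np].
    by rewrite -Np fu.
  by rewrite -Np fu.
have PP q : P q by apply: (locally_constant_connected hM lP (p := p0)).
exists [set y | dot (y - f p0) (N p0) = 0].
  exists (f p0), (N p0); split=> //.
  by apply/eqP => N0; have := NN p0; rewrite N0 dot0l => /eqP; rewrite eq_sym oner_eq0.
apply: open_part_range => [p|p] /=.
  by have [_ fp] := PP p; rewrite dotDl dotNl fp subrr.
(* If [y] is in the plane, [f q - y] is both parallel and orthogonal to the common normal, so
   [y = f q]. *)
have [e e0 eP] := normal_projection p; exists e => // y Qy /eP [q [t [fqy _]]].
exists q => //; apply/eqP; rewrite -subr_eq0 fqy; apply/eqP.
have [Nq fq] := PP q; have := congr1 (fun z => dot z (N p0)) fqy.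
rewrite /= dotZl Nq NN mulr1 dotDl dotNl fq => <-.
by move: Qy; rewrite dotDl dotNl => /eqP; rewrite subr_eq0 => /eqP ->; rewrite subrr scale0r.
Qed.

Lemma nonminimal_soliton_cylinder (p0 : M) : H != 0 ->
  exists2 Q, is_circular_cylinder Q & open_part (range f) Q.
Proof.
(* [rho] is the signed radius; its sign depends on the orientation. *)
move=> H0; pose rho := (2 * H)^-1.
have rho0 : rho != 0 by rewrite invr_eq0 mulf_neq0// pnatr_eq0.
have local p : exists c, atlas c /\ chart_dom c p /\
    exists2 r : R, 0 < r & exists2 e0, dot e0 e0 = 1 &
    forall u, ball (chart_map c p) r u -> [/\ chart_cod c u,
      dot (N (chart_inv c u)) e0 = 0,
      exists t : R, f (chart_inv c u) + rho *: N (chart_inv c u) =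
        f p + rho *: N p + t *: e0 &
      forall e, (\forall y \near u, dot (N (chart_inv c y)) e = 0) ->
        exists s : R, e = s *: e0].
  have [c ac cp] := atlas_cover p; have sp := patch ac.
  have cu := chart_mapP cp; exists c; split=> //; split=> //.
  have := @patch_cylinder _ _ _ _ span _ _ _ H lambda v _ _ sp H0
    (fun u _ => gauss_curvature_eq0 _) (fun u _ => hsol _) cu.
  by rewrite /= (chart_mapK cp).
have [e ee e_near] : exists2 e : 'rV[R]_3, dot e e = 1 &
    \forall y \near p0, dot (N y) e = 0.
  have [c [ac [cp [r r0 [e0 ee rP]]]]] := local p0; exists e0 => //.
  apply: (near_chart cp); apply: filterS (nbhsx_ballx (chart_map c p0) r r0).
  by move=> u /rP[].
pose a := f p0 + rho *: N p0.
(* The centre of curvature lies on the fixed line, and [e] is tangent near [q]. The second condition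
   is stated on a neighbourhood so that the local axis direction must be parallel to [e]. *)
pose P q := (exists t : R, f q + rho *: N q = a + t *: e) /\
  \forall y \near q, dot (N y) e = 0.
have lP p : \forall q \near p, P q <-> P p.
  have [c [ac [cp [r r0 [e0 e00 rP]]]]] := local p.
  (* On one ball all data share the direction [e0], and [e = s e0] with [s] nonzero since [e] is a
     unit vector; so [P] passes from any point of the ball to any other. *)
  have PB u w : ball (chart_map c p) r u -> ball (chart_map c p) r w ->
      P (chart_inv c u) -> P (chart_inv c w).
    move=> pu pw [[t ut] uN].
    have [cu _ [tu uE] us] := rP u pu; have [cw _ [tw wE] _] := rP w pw.
    have [s eE] := us e (chart_near cu uN).
    have s0 : s != 0.
      by apply/eqP => s0; move: ee; rewrite eE s0 scale0r dot0l => /eqP; rewrite eq_sym oner_eq0.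
    split.
      exists (t + (tw - tu) / s); rewrite wE scalerDl addrA -ut uE eE scalerA divfK//.
      by rewrite scalerBl addrACA subrr addr0 -addrA.
    apply: (near_chart (chart_invP cw)); rewrite chart_invK//.
    have oB : open (ball (chart_map c p) r) by exact: ball_open.
    apply: filterS (open_nbhs_nbhs (conj oB pw)) => y py.
    by have [_ Ne _ _] := rP y py; rewrite eE dotZr Ne mulr0.
  apply: (near_chart cp); apply: filterS (nbhsx_ballx (chart_map c p) r r0) => u pu.
  have pp : ball (chart_map c p) r (chart_map c p) by exact: ballxx.
  by split=> [/(PB _ _ pu pp)|Pp]; rewrite ?chart_mapK//; apply: (PB _ _ pp pu); rewrite chart_mapK.
have Pp0 : P p0 by split=> //; exists 0; rewrite scale0r addr0.
have PP q : P q by exact: locally_constant_connected hM lP _ _ Pp0.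
(* Squared distance to the axis along the normal line at [q]: at [t = 0] it shows that the image
   lies on the cylinder, and for general [t] it locates the points of that line on the cylinder. *)
have axis q (t : R) : let y := f q - t *: N q in
    dot (y - a) (y - a) - dot (y - a) e ^+ 2 = (rho + t) ^+ 2.
  have [[s fq] /nbhs_singleton Ne] := PP q; rewrite /=.
  have -> : f q - t *: N q - a = s *: e - (rho + t) *: N q.
    have -> : f q = a + s *: e - rho *: N q by rewrite -fq addrK.
    by apply/rowP => j; rewrite !mxE; ring.
  rewrite !dotE ee NN (dotC e) Ne; ring.
exists [set y | dot (y - a) (y - a) - dot (y - a) e ^+ 2 = `|rho| ^+ 2].
  by exists a, e, `|rho|; split=> //; rewrite normr_gt0.
apply: open_part_range => [p|p] /=.
  by have := axis p 0; rewrite /= scale0r subr0 addr0 real_normK// num_real.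
have [d d0 dP] := normal_projection p.
(* A point of the cylinder on the normal line has [t = 0] or [t = - 2 rho]; the bound [(2 rho) ^ 2]
   rules out the antipodal one. *)
exists (Num.min d ((2 * rho) ^+ 2)).
  by rewrite lt_min d0 exprn_even_gt0//= mulf_neq0// pnatr_eq0.
move=> y Qy; rewrite lt_min => /andP[yd yr].
have [q [t [fqy tp]]] := dP y yd.
have yE : y = f q - t *: N q by rewrite -fqy opprB addrCA subrr addr0.
have := axis q t; rewrite /= -yE Qy real_normK ?num_real// => rt.
have t0 : t = 0.
  apply: contrapT => /eqP tn; have : t * (t + 2 * rho) = 0 by move: rt; lra.
  move/eqP; rewrite mulf_eq0 (negPf tn) addr_eq0 => /eqP tE.
  by have := le_lt_trans tp yr; rewrite tE sqrrN ltxx.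
by exists q => //; rewrite yE t0 scale0r subr0.
Qed.

End Classification.

Theorem theorem1p1 (R : realType) (M : surface R) (f N : M -> 'rV[R]_3)
    (k1 k2 : M -> R) (v : 'rV[R]_3) (lambda : R)
    (hM : connected [set: M])
    (hf : immersion f)
    (hN : gauss_map f N)
    (hk : principal_curvatures f N k1 k2)
    (hv : dot v v = 1)
    (hsol : translating_soliton N k1 k2 v lambda)
    (hH : exists H : R, forall p, mean_curvature k1 k2 p = H) :
  exists2 Q, is_plane Q \/ is_circular_cylinder Q & open_part (range f) Q.
Proof.
have [H hHp] := hH.
have [[p0 _]|M0] := pselect (exists p : M, True); last first.
  (* For an empty surface the image is the empty open part of any plane, here the one through the
     origin with normal [v]. *)
  exists [set y | dot (y - 0) v = 0].
    left; exists 0, v; split=> //.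
    by apply/eqP => v0; move: hv; rewrite v0 dot0l => /eqP; rewrite eq_sym oner_eq0.
  exists set0; first exact: open0.
  rewrite setI0; apply/seteqP; split=> // y [p _ _]; exfalso.
  by apply: M0; exists p.
have [H0|H0] := eqVneq H 0.
  have [Q hQ rQ] := minimal_soliton_plane hM hf hN hk hv hsol hHp p0 H0.
  by exists Q => //; left.
have [Q hQ rQ] := nonminimal_soliton_cylinder hM hf hN hk hv hsol hHp p0 H0.
by exists Q => //; right.
Qed.
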